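(* Let $n\ge 2$ and let $\mathcal{N}$ be a model of the base theory $F$ ($=\mathrm{RCA}_0^*$) that realizes $\mathrm{RT}^{n+1}_2$. Then the Infinite $\Sigma^0_{n-1}$-Pigeonhole Principle (with instances consisting of a $\Sigma^0_{n-1}$ partial coloring together with an infinite set contained in its domain) is Weihrauch reducible over $\mathcal{N}$ to $\mathrm{RT}^{n+1}_2$; the reduction is strong when solutions are represented as infinite sets contained in a single color class (and it is a Weihrauch reduction when solutions are represented as the index of an infinite color class).
   Context: Setting: $\mathcal{N}=(N,\mathcal{P},+,\times,<,0,1)$ with $\mathcal{P}\subseteq 2^N$ is a (possibly nonstandard) second-order model of arithmetic; elements of $N$ are called integers and elements of $\mathcal{P}$ are called sets. $\mathcal{N}$ satisfies the base theory $F$, consisting of $P^-$ (Peano arithmetic without induction), $\mathrm{I}\Delta^0_0$, the totality of exponentiation, and $\Delta^0_1$-comprehension; $F$ is also called $\mathrm{RCA}_0^*$. A formula is $\Delta^0_0$ ($=\Sigma^0_0=\Pi^0_0$) if all its quantifiers are bounded number quantifiers; $\Sigma^0_{m+1}$ formulas are a block of existential number quantifiers followed by a $\Pi^0_m$ formula, and dually for $\Pi^0_{m+1}$. Number and set parameters are allowed. A set is finite iff it is bounded by some integer of $N$, and infinite otherwise. Here $n$ is a standard natural number. (For $n\ge 2$, a model $\mathcal{N}$ realizing $\mathrm{RT}^{n+1}_2$ also realizes arithmetic comprehension, arithmetic induction and arithmetic bounding.) A problem is an arithmetical formula $\mathcal{A}(I,S)$, with no parameters other than $I,S$, asserting that $S$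 is a solution of the instance $I$. $\mathcal{N}$ realizes $\mathcal{A}$ iff in $\mathcal{N}$ for all $I$ there is $S$ with $\mathcal{A}(I,S)$ (an $I$ that is not an instance is by convention given the solution $\emptyset$, so only genuine instances matter). Weihrauch reducibility over $\mathcal{N}$: $\mathcal{A}_0\le_W\mathcal{A}_1$ iff $\mathcal{N}$ realizes $\mathcal{A}_1$ and there are Turing functionals ($\Delta^0_1$-definable partial functions, total on all reasonable oracles from $\mathcal{P}$, i.e. instances $I_0$ of $\mathcal{A}_0$ and solutions $S_1$) $\Phi$ and $\Psi$ such that $\mathcal{N}$ satisfies $\forall I_0\forall S_1\,(\mathcal{A}_1(\Phi(I_0),S_1)\Rightarrow\mathcal{A}_0(I_0,\Psi(I_0,S_1)))$. The reduction is strong if $\Psi$ depends only on $S_1$. Infinite $\Sigma^0_{n-1}$-Pigeonhole Principle as a problem: an instance is a partial coloring $C_0$ from $N$ to some integer $k$, presented by a $\Sigma^0_{n-1}$ definition $\exists w_0\forall w_1\cdots\theta(x,c,\vec w)$ ($\theta$ a $\Delta^0_0$ formula, parameters allowed) of its graph $C_0(x)=c$, together with an infinite set $X\in\mathcal{P}$ contained in the domain of $C_0$. A solution is an infinite subset of $X$ contained in a single color class of $C_0$ (or, in the alternative representation, a color $c<k$ such that $C_0^{-1}(c)\cap X$ is infinite). $\mathrm{RT}^{n+1}_2$ as a problem: an instance is a $2$-coloring $C$ of $[X]^{n+1}=\{Y\subset X\mid |Y|=n+1\}$ for some infinite set $X\subseteq N$; a solution is an infinite set $H\subseteq X$ that is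 homogeneous, i.e. $C$ is constant on $[H]^{n+1}$.
   Formalization: N is also assumed to satisfy Σ^0_1 induction: over F, with infinite meaning unbounded, RT^{n+1}_2 does not imply it, and without it some infinite set is colored injectively below an integer k, so that pigeonhole instance has no solution and the claim fails. *)

(* Defs.v *)
From mathcomp Require Import all_boot.

Set Implicit Arguments.
Unset Strict Implicit.
Unset Printing Implicit Defensive.

Inductive term :=
  | tvar of nat
  | tzero
  | tone
  | tadd of term & term
  | tmul of term & term.

(* Arithmetical formulas.  Variables are named by natural numbers, separately
   for integers and for sets; [fmem t X] is "t belongs to the X-th set".  In
   [fallb v t f] and [fexb v t f] (for all / some v < t) the bound t is outside
   the scope of v. *)
Inductive formula :=
  | feq of term & term
  | flt of term & term
  | fmem of term & nat
  | fnot of formula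
  | fand of formula & formula
  | for_ of formula & formula
  | fimp of formula & formula
  | fall of nat & formula
  | fex of nat & formula
  | fallb of nat & term & formula
  | fexb of nat & term & formula.

Fixpoint delta0 (f : formula) : bool :=
  match f with
  | feq _ _ | flt _ _ | fmem _ _ => true
  | fnot f => delta0 f
  | fand f g | for_ f g | fimp f g => delta0 f && delta0 g
  | fall _ _ | fex _ _ => false
  | fallb _ _ f | fexb _ _ f => delta0 f
  end.

Inductive Sigma : nat -> formula -> Prop :=
  | Sigma_delta0 f : delta0 f -> Sigma 0 f
  | Sigma_Pi m f : Pi m f -> Sigma m.+1 f
  | Sigma_ex m v f : Sigma m.+1 f -> Sigma m.+1 (fex v f)
with Pi : nat -> formula -> Prop :=
  | Pi_delta0 f : delta0 f -> Pi 0 f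
  | Pi_Sigma m f : Sigma m f -> Pi m.+1 f
  | Pi_all m v f : Pi m.+1 f -> Pi m.+1 (fall v f).

Fixpoint occurs (v : nat) (t : term) : bool :=
  match t with
  | tvar w => v == w
  | tzero | tone => false
  | tadd t u | tmul t u => occurs v t || occurs v u
  end.

Fixpoint free (v : nat) (f : formula) : bool :=
  match f with
  | feq t u | flt t u => occurs v t || occurs v u
  | fmem t _ => occurs v t
  | fnot f => free v f
  | fand f g | for_ f g | fimp f g => free v f || free v g
  | fall w f | fex w f => (v != w) && free v f
  | fallb w t f | fexb w t f => occurs v t || (v != w) && free v f
  end.

Record structure := Structure {
  dom :> Type;
  sets : (dom -> Prop) -> Prop;
  zero : dom;
  one : dom;
  add : dom -> dom -> dom;
  mul : dom -> dom -> dom;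
  lt : dom -> dom -> Prop;
  sets_inhabited : exists X, sets X
}.

Definition upd (T : Type) (e : nat -> T) (v : nat) (a : T) : nat -> T :=
  fun w => if w == v then a else e w.

Section Semantics.
Variable N : structure.

Fixpoint eval (e : nat -> N) (t : term) : N :=
  match t with
  | tvar v => e v
  | tzero => zero N
  | tone => one N
  | tadd t u => add (eval e t) (eval e u)
  | tmul t u => mul (eval e t) (eval e u)
  end.

Fixpoint sat (E : nat -> N -> Prop) (e : nat -> N) (f : formula) : Prop :=
  match f with
  | feq t u => eval e t = eval e u
  | flt t u => lt (eval e t) (eval e u)
  | fmem t X => E X (eval e t)
  | fnot f => ~ sat E e f
  | fand f g => sat E e f /\ sat E e g
  | for_ f g => sat E e f \/ sat E e g
  | fimp f g => sat E e f -> sat E e g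
  | fall v f => forall a, sat E (upd e v a) f
  | fex v f => exists a, sat E (upd e v a) f
  | fallb v t f => forall a, lt a (eval e t) -> sat E (upd e v a) f
  | fexb v t f => exists a, lt a (eval e t) /\ sat E (upd e v a) f
  end.

Record P_minus : Prop := {
  addA : forall x y z : N, add (add x y) z = add x (add y z);
  addC : forall x y : N, add x y = add y x;
  mulA : forall x y z : N, mul (mul x y) z = mul x (mul y z);
  mulC : forall x y : N, mul x y = mul y x;
  mulDr : forall x y z : N, mul x (add y z) = add (mul x y) (mul x z);
  add0 : forall x : N, add x (zero N) = x;
  mul0 : forall x : N, mul x (zero N) = zero N;
  mul1 : forall x : N, mul x (one N) = x;
  lt_trans : forall x y z : N, lt x y -> lt y z -> lt x z;
  lt_irr : forall x : N, ~ lt x x;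
  lt_total : forall x y : N, lt x y \/ x = y \/ lt y x;
  lt_add : forall x y z : N, lt x y -> lt (add x z) (add y z);
  lt_mul : forall x y z : N, lt (zero N) z -> lt x y -> lt (mul x z) (mul y z);
  lt_sub : forall x y : N, lt x y -> exists z, add x z = y;
  lt_01 : lt (zero N) (one N);
  lt_discrete : forall x : N, lt (zero N) x -> x = one N \/ lt (one N) x;
  ge0 : forall x : N, x = zero N \/ lt (zero N) x
}.

Definition induction_for (C : formula -> Prop) : Prop :=
  forall f (E : nat -> N -> Prop) (e : nat -> N) v,
    C f -> (forall j, sets (E j)) ->
    sat E (upd e v (zero N)) f ->
    (forall a, sat E (upd e v a) f -> sat E (upd e v (add a (one N))) f) ->
    forall a, sat E (upd e v a) f.

Definition delta1_comprehension : Prop :=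
  forall s p (E : nat -> N -> Prop) (e : nat -> N) v,
    Sigma 1 s -> Pi 1 p -> (forall j, sets (E j)) ->
    (forall a, sat E (upd e v a) s <-> sat E (upd e v a) p) ->
    exists X, sets X /\ forall a, X a <-> sat E (upd e v a) s.

(* Goedel's beta function: r is the remainder of a modulo 1 + (i + 1) * b. *)
Definition beta (a b i r : N) : Prop :=
  let d := add (one N) (mul (add i (one N)) b) in
  lt r d /\ exists q, a = add (mul q d) r.

(* z = x ^ y, witnessed by a beta code (a, b) of the powers x ^ 0, .., x ^ y. *)
Definition exp_graph (x y z : N) : Prop :=
  exists a b,
    [/\ beta a b (zero N) (one N),
        forall i, lt i y ->
          exists u, beta a b i u /\ beta a b (add i (one N)) (mul u x)
      & beta a b y z].

(* The base theory RCA_0^*. *)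
Record models_F : Prop := {
  F_P_minus : P_minus;
  F_induction : induction_for delta0;
  F_exp : forall x y, exists z, exp_graph x y z;
  F_comprehension : delta1_comprehension
}.

(* Variables beyond the listed values denote 0, resp. the empty set, so that
   formulas evaluated in these assignments have no hidden parameters. *)
Definition num_env (s : seq N) : nat -> N := nth (zero N) s.
Definition set_env (s : seq (N -> Prop)) : nat -> N -> Prop :=
  nth (fun _ => False) s.

End Semantics.

(* Set variable 0 stands for the instance I and set variable 1 for the
   solution S. *)
Notation vI := 0 (only parsing).
Notation vS := 1 (only parsing).

Record problem := Problem { inst : formula; sol : formula }.

(* The formula A(I, S); a set that is not an instance has only the solution
   "empty set". *)
Definition problem_formula (A : problem) : formula :=
  for_ (fand (inst A) (sol A))
       (fand (fnot (inst A)) (fall 0 (fnot (fmem (tvar 0) vS)))).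

Definition is_instance (N : structure) (A : problem) (I : N -> Prop) : Prop :=
  sat (set_env [:: I]) (num_env [::]) (inst A).

Definition holds (N : structure) (A : problem) (I S : N -> Prop) : Prop :=
  sat (set_env [:: I; S]) (num_env [::]) (problem_formula A).

Definition realizes (N : structure) (A : problem) : Prop :=
  forall I : N -> Prop, sets I -> exists S, sets S /\ holds A I S.

(* A Turing functional sends oracles (set variables 0, 1, ..) to the set of the
   x (number variable 0) satisfying a Delta^0_1 definition; it is total at the
   oracles for which its Sigma^0_1 and Pi^0_1 forms agree. *)
Record functional := Functional {
  sigma_form : formula;
  pi_form : formula;
  sigma_formP : Sigma 1 sigma_form;
  pi_formP : Pi 1 pi_form
}.

Definition value (N : structure) (F : functional) (o : seq (N -> Prop)) :
    N -> Prop :=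
  fun x => sat (set_env o) (num_env [:: x]) (sigma_form F).

Definition total (N : structure) (F : functional) (o : seq (N -> Prop)) : Prop :=
  forall x, value F o x <->
            sat (set_env o) (num_env [:: x]) (pi_form F).

Definition weihrauch (N : structure) (A0 A1 : problem) : Prop :=
  realizes N A1 /\
  exists Phi Psi : functional,
  forall I0 : N -> Prop, sets I0 -> is_instance A0 I0 ->
    total Phi [:: I0] /\
    forall S1 : N -> Prop, sets S1 -> holds A1 (value Phi [:: I0]) S1 ->
      total Psi [:: I0; S1] /\ holds A0 I0 (value Psi [:: I0; S1]).

Definition strong_weihrauch (N : structure) (A0 A1 : problem) : Prop :=
  realizes N A1 /\
  exists Phi Psi : functional,
  forall I0 : N -> Prop, sets I0 -> is_instance A0 I0 ->
    total Phi [:: I0] /\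
    forall S1 : N -> Prop, sets S1 -> holds A1 (value Phi [:: I0]) S1 ->
      total Psi [:: S1] /\ holds A0 I0 (value Psi [:: S1]).

Definition ftrue : formula := feq tzero tzero.
Definition fconj (s : seq formula) : formula := foldr fand ftrue s.
Definition fiff (f g : formula) : formula := fand (fimp f g) (fimp g f).
Definition falls (vs : seq nat) (f : formula) : formula := foldr fall f vs.
Definition fexs (vs : seq nat) (f : formula) : formula := foldr fex f vs.

Definition tnum (n : nat) : term := iter n (tadd tone) tzero.

(* The pairing <i, j> = (i + j)^2 + i, injective in every model of P^-. *)
Definition tpair (t u : term) : term := tadd (tmul (tadd t u) (tadd t u)) t.

Fixpoint ttuple (t : term) (s : seq term) : term :=
  if s is u :: s' then tpair t (ttuple u s') else t.

(* t belongs to the i-th column { x | <i, x> in I } of I. *)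
Definition fcol (i : nat) (t : term) : formula := fmem (tpair (tnum i) t) vI.

(* Capture-free as long as A mentions no variable besides its argument. *)
Definition finfinite (A : term -> formula) : formula :=
  fall 0 (fex 1 (fand (flt (tvar 0) (tvar 1)) (A (tvar 1)))).

Definition finfinite_solution : formula := finfinite (fmem^~ vS).

Definition fsolution_in_column0 : formula :=
  fall 0 (fimp (fmem (tvar 0) vS) (fcol 0 (tvar 0))).

(* The variables v, .., v + d - 1 form an increasing d-tuple of elements of S. *)
Definition fincreasing_in_S (v d : nat) : formula :=
  fand (fconj [seq fmem (tvar i) vS | i <- iota v d])
       (fconj [seq flt (tvar i) (tvar i.+1) | i <- iota v d.-1]).

Definition fcolor1 (v d : nat) : formula :=
  fcol 1 (ttuple (tvar v) [seq tvar i | i <- iota v.+1 d.-1]).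

(* RT^d_2 (d > 0).  The instance I codes X as its column 0; an increasing tuple
   from X has color 1 if its code is in column 1 of I, and color 0 otherwise. *)
Definition RT2 (d : nat) : problem := {|
  inst := finfinite (fcol 0);
  sol := fconj [::
    finfinite_solution;
    fsolution_in_column0;
    falls (iota 0 (d + d))
      (fimp (fand (fincreasing_in_S 0 d) (fincreasing_in_S d d))
            (fiff (fcolor1 0 d) (fcolor1 d d)))]
|}.

Section Pigeonhole.

(* The formula f(x, c, p_0, .., p_(r-1); P_0, P_1, ..) defines the graph
   C_0(x) = c: x and c are the number variables 0 and 1, the parameter p_j is
   the number variable j + 2, and the parameter P_j is the set variable j.
   An instance I codes X as column 0, {k} as column 1, the p_j through the
   pairs <j, p_j> of column 2, and P_j as column j + 3. *)
Variables (r : nat) (f : formula).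

Fixpoint parameters_from_columns (g : formula) : formula :=
  match g with
  | feq t u => feq t u
  | flt t u => flt t u
  | fmem t j => fcol j.+3 t
  | fnot g => fnot (parameters_from_columns g)
  | fand g h => fand (parameters_from_columns g) (parameters_from_columns h)
  | for_ g h => for_ (parameters_from_columns g) (parameters_from_columns h)
  | fimp g h => fimp (parameters_from_columns g) (parameters_from_columns h)
  | fall v g => fall v (parameters_from_columns g)
  | fex v g => fex v (parameters_from_columns g)
  | fallb v t g => fallb v t (parameters_from_columns g)
  | fexb v t g => fexb v t (parameters_from_columns g)
  end.

(* C_0(x) = c, with x and c the variables 0 and 1. *)
Definition fgraph : formula :=
  fexs (iota 2 r)
    (fand (fconj [seq fcol 2 (tpair (tnum j) (tvar j.+2)) | j <- iota 0 r])
          (parameters_from_columns f)).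

(* Two variables that are not free in fgraph. *)
Let y := r.+2.
Let k := r.+3.

Definition php_instance : formula := fconj [::
  (* the numbers p_j are well defined *)
  fconj [seq fex 1 (fall 0 (fiff (fcol 2 (tpair (tnum j) (tvar 0)))
                                 (feq (tvar 0) (tvar 1)))) | j <- iota 0 r];
  (* the number k is well defined and bounds the colors *)
  fex k (fand (fall 0 (fiff (fcol 1 (tvar 0)) (feq (tvar 0) (tvar k))))
              (fall 0 (fall 1 (fimp fgraph (flt (tvar 1) (tvar k))))));
  (* C_0 is single-valued *)
  fall 0 (fex y (fall 1 (fimp fgraph (feq (tvar 1) (tvar y)))));
  finfinite (fcol 0);
  fall 0 (fimp (fcol 0 (tvar 0)) (fex 1 fgraph))].

Definition PHP : problem := {|
  inst := php_instance;
  sol := fconj [::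
    finfinite_solution;
    fsolution_in_column0;
    fex 1 (fall 0 (fimp (fmem (tvar 0) vS) fgraph))]
|}.

(* The color c is represented by the set {c}. *)
Definition PHP_index : problem := {|
  inst := php_instance;
  sol := fex 1 (fconj [::
    fall 0 (fiff (fmem (tvar 0) vS) (feq (tvar 0) (tvar 1)));
    fex k (fand (fcol 1 (tvar k)) (flt (tvar 1) (tvar k)));
    fall y (fex 0 (fconj [:: flt (tvar y) (tvar 0);
                             fcol 0 (tvar 0); fgraph]))])
|}.

End Pigeonhole.

(* Main.v *)
(* Write the coloring as C_0(x) = c iff some w satisfies h(x, c, w) with h a
   Pi_(n-2) formula, and let h(e; z_1, .., z_(n-2)) be h with its blocks of
   quantifiers bounded by the z_i.  By collection, h(e; z) has the truth value of
   h(e), uniformly in all e below a given bound, as soon as z_1 is large enough,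
   z_2 is large enough depending on z_1, and so on.  Color a_0 < .. < a_n by 1 iff
   - h(e; a_2, .., a_(n-1)) and h(e; a_3, .., a_n) agree for all e < a_0, and
   - a_0 and a_1 get a common color c < a_2 according to h(.; a_3, .., a_n) with
     witnesses w < a_2.
   Let H be infinite and homogeneous.  For far away a_2 < .. < a_n in H, the color
   is 1 iff C_0(a_0) = C_0(a_1).  So if H had color 0, then C_0 would be injective
   on H, against the pigeonhole principle; hence H has color 1 and is contained
   in a color class.  Moreover, shifting one element at a time towards far away
   tuples shows that h(e; z) is correct for all increasing z in H above e, so that
   the color of the elements of H is Delta^0_1 in H and the instance.

   The pigeonhole principle and collection needed here come from arithmetical
   comprehension, which in turn follows from Ramsey's theorem for triples: color
   a < b < c by whether every p < a with a witness below c has one below b. *)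

From mathcomp Require Import all_boot.
From Stdlib Require Import Classical Ring.
Require Import Defs.

Set Implicit Arguments.
Unset Strict Implicit.
Unset Printing Implicit Defensive.

(** * Formulas: extensionality, substitution, blocks of quantifiers *)

(** Definability occurs in two forms. Sets formed within the verification may use arbitrary
    parameters; this is [D0], and after arithmetical comprehension every arithmetical relation is of
    this kind. The functionals are formulas fixed before the instance is known, so the bounded form
    of h must be correct for all set assignments at once and is chosen by syntax. A bounded form is
    reliable only for sparse bounds, and sparseness cannot be read off from the instance. For far
    tuples the agreement clause of the coloring holds automatically; it is there so that homogeneity
    carries it to all tuples of H, which can then be trusted when the color is computed. The
    exponent is a count: with m = n - 2 blocks in h, two windows of m bounds shifted by one occupy m
    + 1 entries, and a_0, a_1 make this m + 3 = n + 1. The entry a_2 also bounds the color and the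
    outermost witnesses. Sigma^0_1 induction, assumed in the theorem, enters through least elements
    and the exclusion of infinite descent. *)

Lemma ex_iff (T : Type) (P Q : T -> Prop) :
  (forall x, P x <-> Q x) -> (exists x, P x) <-> (exists x, Q x).
Proof. by move=> PQ; split=> -[x /PQ Hx]; exists x. Qed.

Lemma all_iff (T : Type) (P Q : T -> Prop) :
  (forall x, P x <-> Q x) -> (forall x, P x) <-> (forall x, Q x).
Proof. by move=> PQ; split=> H x; apply/PQ. Qed.

Lemma and_iff (A B C D : Prop) : (A <-> B) -> (C <-> D) -> (A /\ C <-> B /\ D).
Proof. tauto. Qed.

Lemma or_iff (A B C D : Prop) : (A <-> B) -> (C <-> D) -> (A \/ C <-> B \/ D).
Proof. tauto. Qed.

Lemma imp_iff (A B C D : Prop) :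
  (A <-> B) -> (C <-> D) -> ((A -> C) <-> (B -> D)).
Proof. tauto. Qed.

Lemma upd_eq (T : Type) (e : nat -> T) v a : upd e v a v = a.
Proof. by rewrite /upd eqxx. Qed.

Lemma upd_neq (T : Type) (e : nat -> T) v a w : w != v -> upd e v a w = e w.
Proof. by rewrite /upd => /negbTE ->. Qed.

Fixpoint tbound (t : term) : nat :=
  match t with
  | tvar v => v.+1
  | tzero | tone => 0
  | tadd t u | tmul t u => maxn (tbound t) (tbound u)
  end.

Fixpoint fbound (f : formula) : nat :=
  match f with
  | feq t u | flt t u => maxn (tbound t) (tbound u)
  | fmem t _ => tbound t
  | fnot f => fbound f
  | fand f g | for_ f g | fimp f g => maxn (fbound f) (fbound g)
  | fall v f | fex v f => maxn v.+1 (fbound f)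
  | fallb v t f | fexb v t f => maxn v.+1 (maxn (tbound t) (fbound f))
  end.

Lemma occurs_tbound v t : occurs v t -> v < tbound t.
Proof.
elim: t => //= [w /eqP -> //|t IHt u IHu /orP[/IHt|/IHu]|t IHt u IHu /orP[/IHt|/IHu]];
by rewrite leq_max => ->; rewrite ?orbT.
Qed.

Lemma free_fbound v f : free v f -> v < fbound f.
Proof.
elim: f => //=; do ?[
  by move=> t u /orP[]/occurs_tbound; rewrite leq_max => ->; rewrite ?orbT
| by move=> f IHf g IHg /orP[/IHf|/IHg]; rewrite leq_max => ->; rewrite ?orbT
| by move=> w f IHf /andP[_ /IHf]; rewrite leq_max => ->; rewrite ?orbT
| by move=> w t f IHf /orP[/occurs_tbound|/andP[_ /IHf]];
     rewrite !leq_max => ->; rewrite ?orbT].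
by move=> t _ /occurs_tbound.
Qed.

Section Syntax.
Variable N : structure.
Implicit Types (E : nat -> N -> Prop) (e : nat -> N).

Lemma eval_ext e e' t :
  (forall v, occurs v t -> e v = e' v) -> eval e t = eval e' t.
Proof.
elim: t => //= [v H|t IHt u IHu H|t IHt u IHu H]; first exact: H.
  by rewrite IHt ?IHu // => v Hv; apply: H; rewrite Hv ?orbT.
by rewrite IHt ?IHu // => v Hv; apply: H; rewrite Hv ?orbT.
Qed.

Lemma sat_ext E E' e e' f :
  (forall v, free v f -> e v = e' v) -> (forall j x, E j x <-> E' j x) ->
  sat E e f <-> sat E' e' f.
Proof.
move=> He HE; elim: f e e' He => /=;
  do ?[move=> f IHf g IHg e e' He;
       have {}IHf := IHf e e' (fun v Hv => He v (introT orP (or_introl Hv)));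
       have {}IHg := IHg e e' (fun v Hv => He v (introT orP (or_intror Hv)));
       tauto].
- move=> t u e e' He; rewrite (@eval_ext e e' t) ?(@eval_ext e e' u) // => v Hv;
  by apply: He; rewrite Hv ?orbT.
- move=> t u e e' He; rewrite (@eval_ext e e' t) ?(@eval_ext e e' u) // => v Hv;
  by apply: He; rewrite Hv ?orbT.
- by move=> t j e e' He; rewrite (eval_ext He).
- by move=> f IHf e e' /IHf; tauto.
- move=> v f IHf e e' He; apply: all_iff => a; apply: IHf => w Hw; rewrite /upd.
  by case: eqP => // /eqP Hwv; apply: He; rewrite Hwv.
- move=> v f IHf e e' He; apply: ex_iff => a; apply: IHf => w Hw; rewrite /upd.
  by case: eqP => // /eqP Hwv; apply: He; rewrite Hwv.
- move=> v t f IHf e e' He.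
  rewrite (@eval_ext e e' t); last by move=> w Hw; apply: He; rewrite Hw.
  apply: all_iff => a; apply: imp_iff => //; apply: IHf => w Hw; rewrite /upd.
  by case: eqP => // /eqP Hwv; apply: He; rewrite Hwv Hw orbT.
- move=> v t f IHf e e' He.
  rewrite (@eval_ext e e' t); last by move=> w Hw; apply: He; rewrite Hw.
  apply: ex_iff => a; apply: and_iff => //; apply: IHf => w Hw; rewrite /upd.
  by case: eqP => // /eqP Hwv; apply: He; rewrite Hwv Hw orbT.
Qed.

Lemma sat_eq E e e' f : (forall v, e v = e' v) -> sat E e f <-> sat E e' f.
Proof. by move=> He; apply: sat_ext. Qed.

End Syntax.

Fixpoint tsub (s : nat -> term) (t : term) : term :=
  match t with
  | tvar v => s v
  | tzero => tzero
  | tone => tone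
  | tadd t u => tadd (tsub s t) (tsub s u)
  | tmul t u => tmul (tsub s t) (tsub s u)
  end.

(** Used with m the variable bound of a body: the result lies above every variable of the terms put
    for the free variables of that body, so binding it captures nothing. *)
Definition fresh (s : nat -> term) (m : nat) : nat :=
  foldr maxn 0 [seq tbound (s u) | u <- iota 0 m].

(* Capture-avoiding substitution of terms for number variables, together with a
   renaming of the set variables. *)
Fixpoint fsub (s : nat -> term) (p : nat -> nat) (f : formula) : formula :=
  match f with
  | feq t u => feq (tsub s t) (tsub s u)
  | flt t u => flt (tsub s t) (tsub s u)
  | fmem t j => fmem (tsub s t) (p j)
  | fnot f => fnot (fsub s p f)
  | fand f g => fand (fsub s p f) (fsub s p g)
  | for_ f g => for_ (fsub s p f) (fsub s p g)
  | fimp f g => fimp (fsub s p f) (fsub s p g)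
  | fall v f =>
    let w := fresh s (fbound f) in fall w (fsub (upd s v (tvar w)) p f)
  | fex v f =>
    let w := fresh s (fbound f) in fex w (fsub (upd s v (tvar w)) p f)
  | fallb v t f =>
    let w := fresh s (fbound f) in
    fallb w (tsub s t) (fsub (upd s v (tvar w)) p f)
  | fexb v t f =>
    let w := fresh s (fbound f) in
    fexb w (tsub s t) (fsub (upd s v (tvar w)) p f)
  end.

Lemma fresh_bound s m u : u < m -> tbound (s u) <= fresh s m.
Proof.
move=> um; rewrite /fresh.
have: u \in iota 0 m by rewrite mem_iota add0n um.
elim: (iota 0 m) => //= w l IHl; rewrite inE leq_max => /orP[/eqP -> |/IHl ->].
  by rewrite leqnn.
by rewrite orbT.
Qed.

Lemma delta0_fsub s p f : delta0 (fsub s p f) = delta0 f.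
Proof.
by elim: f s => //= [f IHf g IHg|f IHf g IHg|f IHf g IHg] s; rewrite IHf IHg.
Qed.

Section Blocks.
Variable N : structure.
Implicit Types (E : nat -> N -> Prop) (e : nat -> N).

Lemma eval_tsub e s t : eval e (tsub s t) = eval (fun u => eval e (s u)) t.
Proof. by elim: t => //= t -> u ->. Qed.

Lemma sat_fsub E e s p f :
  sat E e (fsub s p f) <-> sat (fun j => E (p j)) (fun u => eval e (s u)) f.
Proof.
have upd_sub e' s' v a g :
    sat (fun j => E (p j))
      (fun u => eval (upd e' (fresh s' (fbound g)) a)
                     (upd s' v (tvar (fresh s' (fbound g))) u)) g <->
    sat (fun j => E (p j)) (upd (fun u => eval e' (s' u)) v a) g.
  apply: sat_ext => // u /free_fbound/(fresh_bound s') Hu; rewrite /upd.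
  case: eqP => _ /=; first by rewrite eqxx.
  apply: eval_ext => w /occurs_tbound Hw; rewrite ifF //.
  by apply: ltn_eqF; apply: leq_trans Hw Hu.
elim: f s e => /=.
- by move=> t u s e; rewrite !eval_tsub.
- by move=> t u s e; rewrite !eval_tsub.
- by move=> t j s e; rewrite !eval_tsub.
- by move=> f IHf s e; rewrite IHf.
- by move=> f IHf g IHg s e; rewrite IHf IHg.
- by move=> f IHf g IHg s e; rewrite IHf IHg.
- by move=> f IHf g IHg s e; rewrite IHf IHg.
- by move=> v f IHf s e; apply: all_iff => a; rewrite IHf upd_sub.
- by move=> v f IHf s e; apply: ex_iff => a; rewrite IHf upd_sub.
- move=> v t f IHf s e; rewrite eval_tsub; apply: all_iff => a.
  by rewrite IHf upd_sub.
- move=> v t f IHf s e; rewrite eval_tsub; apply: ex_iff => a.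
  by rewrite IHf upd_sub.
Qed.

Definition agree_off (vs : seq nat) e e' := forall i, i \notin vs -> e' i = e i.

Lemma sat_fexs E e vs f :
  sat E e (fexs vs f) <-> exists e', agree_off vs e e' /\ sat E e' f.
Proof.
elim: vs e => [|v vs IHvs] e /=.
  split=> [He|[e' [He' ]]]; first by exists e.
  by apply: (iffRL (sat_eq _ _ _)) => v; rewrite He'.
split=> [[a /IHvs[e' [He' Hf]]]|[e' [He' Hf]]].
  exists e'; split=> // i; rewrite inE negb_or => /andP[iv ivs].
  by rewrite He' // upd_neq.
(* If v occurs again in [vs], this value is overwritten by an inner quantifier, so the final value
   [e' v] is always a correct choice. *)
exists (e' v); apply/IHvs; exists e'; split=> // i ivs; rewrite /upd.
by case: eqP => [-> //|/eqP iv]; apply: He'; rewrite inE negb_or iv.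
Qed.

Lemma sat_falls E e vs f :
  sat E e (falls vs f) <-> forall e', agree_off vs e e' -> sat E e' f.
Proof.
elim: vs e => [|v vs IHvs] e /=.
  split=> [He e' He'|]; last by apply.
  by apply: (iffRL (sat_eq _ _ _)) He => v; rewrite He'.
split=> [H e' He'|H a].
  have /IHvs := H (e' v); apply=> i ivs; rewrite /upd.
  by case: eqP => [-> //|/eqP iv]; apply: He'; rewrite inE negb_or iv.
apply/IHvs => e' He'; apply: H => i; rewrite inE negb_or => /andP[iv ivs].
by rewrite He' // upd_neq.
Qed.

Definition fexbs (vs : seq nat) (t : term) (f : formula) : formula :=
  foldr (fun v => fexb v t) f vs.
Definition fallbs (vs : seq nat) (t : term) (f : formula) : formula :=
  foldr (fun v => fallb v t) f vs.

Lemma eval_upd e v a t : ~~ occurs v t -> eval (upd e v a) t = eval e t.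
Proof.
move=> vt; apply: eval_ext => w wt; rewrite upd_neq //.
by apply: contraNneq vt => <-.
Qed.

(** The side condition is needed because the bound of an inner quantifier is evaluated after the
    outer variables of [vs] have been reassigned. *)
Lemma sat_fexbs E e vs t f : {in vs, forall v, ~~ occurs v t} ->
  sat E e (fexbs vs t f) <->
  exists e', [/\ agree_off vs e e', {in vs, forall i, lt (e' i) (eval e t)}
               & sat E e' f].
Proof.
elim: vs e => [|v vs IHvs] e Ht /=.
  split=> [He|[e' [He' _]]]; first by exists e.
  by apply: (iffRL (sat_eq _ _ _)) => v; rewrite He'.
have vt : ~~ occurs v t by apply: Ht; rewrite inE eqxx.
have {}IHvs := IHvs _ (fun u Hu => Ht u (mem_behead (s := v :: vs) Hu)).
split=> [[a [Ha /IHvs[e' [He' Hl Hf]]]]|[e' [He' Hl Hf]]].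
  exists e'; split=> // i.
    by rewrite inE negb_or => /andP[iv ivs]; rewrite He' // upd_neq.
  move: (Hl i); rewrite inE eval_upd //.
  case: (boolP (i \in vs)) => [_ /(_ isT) //|ivs _ /=]; rewrite orbF.
  by move/eqP=> iv; rewrite He' // iv upd_eq.
exists (e' v); split; first by apply: Hl; rewrite inE eqxx.
apply/IHvs; exists e'; split=> // [i ivs|i ivs]; last first.
  by rewrite eval_upd //; apply: Hl; rewrite inE ivs orbT.
rewrite /upd; case: eqP => [-> //|/eqP iv].
by apply: He'; rewrite inE negb_or iv.
Qed.

Lemma sat_fallbs E e vs t f : {in vs, forall v, ~~ occurs v t} ->
  sat E e (fallbs vs t f) <->
  forall e', agree_off vs e e' -> {in vs, forall i, lt (e' i) (eval e t)} ->
    sat E e' f.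
Proof.
move=> Ht; have := sat_fexbs E e (fnot f) Ht.
have -> : sat E e (fexbs vs t (fnot f)) <-> ~ sat E e (fallbs vs t f).
  elim: vs e {Ht} => //= v vs IHvs e; split=> [[a [Ha /IHvs H]] H'|H].
    exact/H/H'.
  apply: NNPP => H'; apply: H => a Ha; apply: NNPP => /IHvs H.
  by apply: H'; exists a.
move=> H; split=> [Hf e' He' Hl|Hf].
  by apply: NNPP => Hnf; apply: (iffRL H) => //; exists e'.
by apply: NNPP => /H[e' [He' Hl []]]; apply: Hf.
Qed.

Lemma sat_fconj3 E e f g h :
  sat E e (fconj [:: f; g; h]) <-> [/\ sat E e f, sat E e g & sat E e h].
Proof. by split=> [[? [? []]]|[]]. Qed.

Lemma sat_fimp E e f g : sat E e (fimp f g) <-> (sat E e f -> sat E e g).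
Proof. by []. Qed.

Lemma sat_fand E e f g : sat E e (fand f g) <-> sat E e f /\ sat E e g.
Proof. by []. Qed.

Lemma sat_for E e f g : sat E e (for_ f g) <-> sat E e f \/ sat E e g.
Proof. by []. Qed.

Lemma sat_fiff E e f g : sat E e (fiff f g) <-> (sat E e f <-> sat E e g).
Proof. by []. Qed.

Lemma holdsE (A : problem) (I S : N -> Prop) : holds A I S <->
  sat (set_env [:: I; S]) (num_env [::]) (inst A) /\
  sat (set_env [:: I; S]) (num_env [::]) (sol A) \/
  ~ sat (set_env [:: I; S]) (num_env [::]) (inst A) /\ forall x, ~ S x.
Proof. by []. Qed.

Lemma sat_fconj E e (s : seq nat) (F : nat -> formula) :
  sat E e (fconj [seq F i | i <- s]) <-> {in s, forall i, sat E e (F i)}.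
Proof.
elim: s => [|i s IHs] /=; first by split.
rewrite IHs; split=> [[Hi Hs] j|H].
  by rewrite inE => /orP[/eqP -> //|]; apply: Hs.
by split=> [|j js]; apply: H; rewrite inE ?eqxx ?js ?orbT.
Qed.

End Blocks.

Lemma fexs_Sigma m vs f : Sigma m.+1 f -> Sigma m.+1 (fexs vs f).
Proof. by move=> Hf; elim: vs => //= v vs; apply: Sigma_ex. Qed.

Lemma falls_Pi m vs f : Pi m.+1 f -> Pi m.+1 (falls vs f).
Proof. by move=> Hf; elim: vs => //= v vs; apply: Pi_all. Qed.

Lemma delta0_Sigma1 f : delta0 f -> Sigma 1 f.
Proof. by move=> Hf; apply/Sigma_Pi/Pi_delta0. Qed.

Lemma delta0_Pi1 f : delta0 f -> Pi 1 f.
Proof. by move=> Hf; apply/Pi_Sigma/Sigma_delta0. Qed.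

Lemma delta0_fexbs vs t f : delta0 (fexbs vs t f) = delta0 f.
Proof. by elim: vs. Qed.

Lemma delta0_fallbs vs t f : delta0 (fallbs vs t f) = delta0 f.
Proof. by elim: vs. Qed.

Lemma delta0_fconj (s : seq nat) (F : nat -> formula) :
  (forall i, delta0 (F i)) -> delta0 (fconj [seq F i | i <- s]).
Proof. by move=> HF; elim: s => //= i s ->; rewrite HF. Qed.

Lemma Sigma_block m f : Sigma m.+1 f -> exists vs h, f = fexs vs h /\ Pi m h.
Proof.
move=> Hf; remember m.+1 as m' eqn:Em; elim: Hf m Em => //.
  by move=> m'' h Hh m [<-]; exists [::], h.
by move=> m'' v h _ IHh m /IHh[vs [h' [-> Hh']]]; exists (v :: vs), h'.
Qed.

Lemma Pi_block m f : Pi m.+1 f -> exists vs h, f = falls vs h /\ Sigma m h.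
Proof.
move=> Hf; remember m.+1 as m' eqn:Em; elim: Hf m Em => //.
  by move=> m'' h Hh m [<-]; exists [::], h.
by move=> m'' v h _ IHh m /IHh[vs [h' [-> Hh']]]; exists (v :: vs), h'.
Qed.

(** * Arithmetic and pairing in models of P^- *)

Definition pair (N : structure) (a b : N) : N :=
  add (mul (add a b) (add a b)) a.

Fixpoint tuple (N : structure) (a : N) (s : seq N) : N :=
  if s is b :: s' then pair a (tuple b s') else a.

Definition le (N : structure) (x y : N) : Prop := x = y \/ lt x y.

Definition num (N : structure) (n : nat) : N := iter n (add (one N)) (zero N).

Lemma eval_tnum (N : structure) (e : nat -> N) n : eval e (tnum n) = num N n.
Proof. by elim: n => //= n <-. Qed.

Lemma eval_tpair (N : structure) (e : nat -> N) t u :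
  eval e (tpair t u) = pair (eval e t) (eval e u).
Proof. by []. Qed.

Lemma eval_ttuple (N : structure) (e : nat -> N) t s :
  eval e (ttuple t s) = tuple (eval e t) [seq eval e u | u <- s].
Proof. by elim: s t => //= u s IHs t; rewrite /pair IHs. Qed.

Section Arithmetic.
Variables (N : structure) (PA : P_minus N).
Implicit Types x y z a b c : N.

Lemma peano_semiring :
  semi_ring_theory (zero N) (one N) (@add N) (@mul N) (@eq N).
Proof.
split=> *.
- by rewrite (addC PA) (add0 PA).
- exact: addC.
- by rewrite (addA PA).
- by rewrite (mulC PA) (mul1 PA).
- by rewrite (mulC PA) (mul0 PA).
- exact: mulC.
- by rewrite (mulA PA).
- by rewrite (mulC PA) (mulDr PA); congr add; apply: mulC.
Qed.
Add Ring peano_ring : peano_semiring.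

Let ltT := lt_trans PA.

Lemma le_refl x : le x x. Proof. by left. Qed.
Lemma lt_le x y : lt x y -> le x y. Proof. by right. Qed.

Lemma le_lt_trans x y z : le x y -> lt y z -> lt x z.
Proof. by case=> [->|] //; apply: ltT. Qed.

Lemma lt_le_trans x y z : lt x y -> le y z -> lt x z.
Proof. by move=> xy [<-|] //; apply: ltT. Qed.

Lemma le_trans x y z : le x y -> le y z -> le x z.
Proof. by move=> xy [<-|yz] //; right; apply: le_lt_trans yz. Qed.

Lemma le_not_lt x y : le x y -> ~ lt y x.
Proof. by move=> xy yx; apply: (lt_irr PA (le_lt_trans xy yx)). Qed.

Lemma not_lt_le x y : ~ lt y x -> le x y.
Proof. by have := lt_total PA x y; rewrite /le; tauto. Qed.

Lemma zero_le x : le (zero N) x.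
Proof. by case: (ge0 PA x) => [->|]; [left|right]. Qed.

Lemma not_lt_zero x : ~ lt x (zero N).
Proof. exact/le_not_lt/zero_le. Qed.

Lemma add_lt_l x y z : lt x y -> lt (add z x) (add z y).
Proof. by rewrite !(addC PA z); apply: lt_add. Qed.

Lemma add_le x y z t : le x y -> le z t -> le (add x z) (add y t).
Proof.
move=> xy zt; apply: (@le_trans _ (add y z)).
  by case: xy => [->|/(lt_add PA z)]; [left|right].
by case: zt => [->|/(add_lt_l y)]; [left|right].
Qed.

Lemma mul_le x y z t : le x y -> le z t -> le (mul x z) (mul y t).
Proof.
have mono a b c : le a b -> le (mul a c) (mul b c).
  case: (ge0 PA c) => [->|c0]; first by rewrite !(mul0 PA); left.
  by case=> [->|/(lt_mul PA c0)]; [left|right].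
move=> xy zt; apply: (@le_trans _ (mul y z)); first exact: mono.
by rewrite !(mulC PA y); apply: mono.
Qed.

Lemma le_add_r x y : le x (add x y).
Proof. by rewrite -{1}(add0 PA x); apply: add_le (le_refl _) (zero_le _). Qed.

Lemma le_add_l x y : le x (add y x).
Proof. by rewrite (addC PA); apply: le_add_r. Qed.

Lemma lt_succ x : lt x (add x (one N)).
Proof. by rewrite -{1}(add0 PA x); apply/add_lt_l/lt_01. Qed.

Lemma le_lt_succ x y : le x y -> lt x (add y (one N)).
Proof. by move=> xy; apply: le_lt_trans (lt_succ y). Qed.

Lemma lt_succ_le x y : lt x y -> le (add x (one N)) y.
Proof.
move=> xy; have [z Ez] := lt_sub PA xy; rewrite -Ez.
apply: add_le; first exact: le_refl.
case: (ge0 PA z) => [z0|/(lt_discrete PA)[->|]]; [|by left|by right].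
by case: (lt_irr PA (x := x)); rewrite -{2}(add0 PA x) -z0 Ez.
Qed.

Lemma lt_succ_iff x y : lt x (add y (one N)) <-> le x y.
Proof.
split; last exact: le_lt_succ.
move=> xy; apply: not_lt_le => /lt_succ_le yx.
exact: le_not_lt yx xy.
Qed.

Lemma ltl_max x y : exists z, lt x z /\ lt y z.
Proof.
exists (add (add x y) (one N)).
split; apply/le_lt_succ; [exact: le_add_r | exact: le_add_l].
Qed.

Lemma add_inj_l z x y : add z x = add z y -> x = y.
Proof.
move=> E; case: (lt_total PA x y) => [|[//|]] /(add_lt_l z);
by rewrite E => /(lt_irr PA).
Qed.

(** With s = a + b the code lies between s^2 and s^2 + s, hence below (s + 1)^2: codes are ordered
    by the sum of the components first. Injectivity follows, since the code determines s. *)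
Lemma pair_lt a b c d : lt (add a b) (add c d) -> lt (pair a b) (pair c d).
Proof.
move=> /lt_succ_le lt_s; rewrite /pair.
have := mul_le lt_s lt_s.
have -> : mul (add (add a b) (one N)) (add (add a b) (one N)) =
  add (add (add (mul (add a b) (add a b)) a)
    (add (add a b) b)) (one N) by ring.
move=> /(lt_le_trans _) H; apply: (@lt_le_trans _ (mul (add c d) (add c d))).
  by apply: H; apply/le_lt_succ/le_add_r.
exact: le_add_r.
Qed.

Lemma pair_inj a b c d : pair a b = pair c d -> a = c /\ b = d.
Proof.
move=> E.
have Es : add a b = add c d.
  by case: (lt_total PA (add a b) (add c d)) => [|[//|]] /pair_lt;
  rewrite E => /(lt_irr PA).
move: E; rewrite /pair Es => /add_inj_l Ea; split=> //.
by move: Es; rewrite Ea; apply: add_inj_l.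
Qed.

Lemma le_pair_l a b : le a (pair a b).
Proof. exact: le_add_l. Qed.

Lemma le_pair_r a b : le b (pair a b).
Proof.
apply: (@le_trans _ (mul (add a b) (add a b))); last exact: le_add_r.
case: (ge0 PA b) => [->|b0]; first exact: zero_le.
apply: (@le_trans _ (mul b (one N))); first by rewrite (mul1 PA); left.
apply: mul_le; first exact: le_add_l.
apply: (@le_trans _ b); last exact: le_add_l.
by case: (lt_discrete PA b0) => [->|]; [left|right].
Qed.

Lemma pair_le a b c d : le a c -> le b d -> le (pair a b) (pair c d).
Proof.
by move=> ac bd; apply: add_le => //; apply: mul_le; apply: add_le.
Qed.

Lemma num_inj m n : num N m = num N n -> m = n.
Proof.
elim: m n => [|m IHm] [|n] //= E.
- case: (@not_lt_zero (num N n)); rewrite E (addC PA).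
  exact: lt_succ.
- case: (@not_lt_zero (num N m)); rewrite -E (addC PA).
  exact: lt_succ.
- by rewrite (IHm n) //; apply: add_inj_l E.
Qed.

(** Codes do not record lengths, as every number is the code of a one-element tuple; only tuples of
    equal length can be compared. *)
Lemma tuple_inj a b s t : size s = size t ->
  tuple a s = tuple b t -> a = b /\ s = t.
Proof.
elim: s t a b => [|c s IHs] [|d t] a b //= [Est].
by move=> /pair_inj[-> /(IHs _ _ _ Est)[-> ->]].
Qed.

Lemma le_tuple_head a s : le a (tuple a s).
Proof. by case: s => [|b s] /=; [left | apply: le_pair_l]. Qed.

Lemma le_tuple_nth a s i : i < (size s).+1 ->
  le (nth (zero N) (a :: s) i) (tuple a s).
Proof.
elim: s a i => [|b s IHs] a [|i] //= Hi; do ?[by left | exact: le_pair_l].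
exact: (le_trans (IHs b i Hi) (le_pair_r _ _)).
Qed.

(** This turns collection over assignments with bounded values into collection over the numbers that
    code them. *)
Lemma tuple_bound n c : exists d, forall a s, size s = n ->
  (forall i, i < n.+1 -> le (nth (zero N) (a :: s) i) c) -> le (tuple a s) d.
Proof.
elim: n => [|n [d IH]].
  by exists c => a [|//] _ /(_ 0 isT).
exists (pair c d) => a [|b s] //= [Es] Hs.
by apply: pair_le; [apply: (Hs 0) | apply: IH => // i Hi; apply: (Hs i.+1)].
Qed.

End Arithmetic.

(** * Bounded definability with parameters *)

Section Definability.
Variable N : structure.
Local Notation env := (nat -> N).

(* The even variables hold the arguments, the odd ones number parameters. *)
Definition mix (c e : env) : env := fun i => if odd i then c i./2 else e i./2.

Definition scons (a : N) (e : env) : env := fun i => if i is j.+1 then e j else a.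

(* Predicates and functions of an assignment that are Delta^0_0-definable, resp.
   given by a term, with number and set parameters. *)
Definition D0 (R : env -> Prop) : Prop := exists f E c,
  [/\ delta0 f, forall j, sets (E j) & forall e, R e <-> sat E (mix c e) f].

Definition DT (t : env -> N) : Prop :=
  exists tm c, forall e, t e = eval (mix c e) tm.

(** Two parameter assignments are merged into [mix c2 c1], with c1 in the even and c2 in the odd
    places. Parameters themselves sit at odd variables, so the k-th entry of c1 moves to variable 4k
    + 1 and that of c2 to variable 4k + 3. *)
Definition subl i := tvar (if odd i then 4 * i./2 + 1 else i).
Definition subr i := tvar (if odd i then 4 * i./2 + 3 else i).

Lemma mix_subl c1 c2 e i : eval (mix (mix c2 c1) e) (subl i) = mix c1 e i.
Proof.
rewrite /subl; case Hi: (odd i) => /=; last by rewrite /mix Hi.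
have -> : 4 * i./2 + 1 = (i./2.*2).*2.+1 by rewrite -!mul2n mulnA addn1.
by rewrite /mix Hi /= odd_double /= uphalf_double odd_double doubleK.
Qed.

Lemma mix_subr c1 c2 e i : eval (mix (mix c2 c1) e) (subr i) = mix c2 e i.
Proof.
rewrite /subr; case Hi: (odd i) => /=; last by rewrite /mix Hi.
have -> : 4 * i./2 + 3 = (i./2.*2.+1).*2.+1.
  by rewrite -!mul2n mulnS mulnA addnC.
rewrite /mix Hi /= odd_double /= uphalf_double /= odd_double /=.
by rewrite uphalf_double.
Qed.

(** The parameter assignment is made explicit so that two definitions can be moved to a common one
    before a connective joins them. *)
Definition params (c : env) (R : env -> Prop) : Prop := exists f E,
  [/\ delta0 f, forall j, sets (E j) & forall e, R e <-> sat E (mix c e) f].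

Definition tparams (c : env) (t : env -> N) : Prop :=
  exists tm, forall e, t e = eval (mix c e) tm.

Lemma params_l c c' R : params c R -> params (mix c' c) R.
Proof.
move=> [f [E [Hf HE HR]]]; exists (fsub subl id f), E.
split; rewrite ?delta0_fsub // => e; rewrite HR sat_fsub.
by apply: sat_eq => i; rewrite mix_subl.
Qed.

Lemma params_r c c' R : params c R -> params (mix c c') R.
Proof.
move=> [f [E [Hf HE HR]]]; exists (fsub subr id f), E.
split; rewrite ?delta0_fsub // => e; rewrite HR sat_fsub.
by apply: sat_eq => i; rewrite mix_subr.
Qed.

Lemma tparams_l c c' t : tparams c t -> tparams (mix c' c) t.
Proof.
move=> [tm Ht]; exists (tsub subl tm) => e; rewrite Ht eval_tsub.
by apply: eval_ext => i _; rewrite mix_subl.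
Qed.

Lemma tparams_r c c' t : tparams c t -> tparams (mix c c') t.
Proof.
move=> [tm Ht]; exists (tsub subr tm) => e; rewrite Ht eval_tsub.
by apply: eval_ext => i _; rewrite mix_subr.
Qed.

Lemma D0_params R : D0 R <-> exists c, params c R.
Proof.
by split=> [[f [E [c H]]]|[c [f [E H]]]]; [exists c, f, E | exists f, E, c].
Qed.

Lemma DT_tparams t : DT t <-> exists c, tparams c t.
Proof. by split=> [[tm [c H]]|[c [tm H]]]; [exists c, tm | exists tm, c]. Qed.

Definition interleave (E1 E2 : nat -> N -> Prop) : nat -> N -> Prop :=
  fun j => if odd j then E2 j./2 else E1 j./2.

Lemma params_merge c R1 R2 : params c R1 -> params c R2 ->
  exists f1 f2 E, [/\ delta0 f1, delta0 f2, forall j, sets (E j)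
    & forall e, (R1 e <-> sat E (mix c e) f1) /\ (R2 e <-> sat E (mix c e) f2)].
Proof.
move=> [f1 [E1 [Hf1 HE1 HR1]]] [f2 [E2 [Hf2 HE2 HR2]]].
exists (fsub tvar (fun j => j.*2) f1), (fsub tvar (fun j => j.*2.+1) f2),
  (interleave E1 E2).
split; rewrite ?delta0_fsub //; first by move=> j; rewrite /interleave; case: ifP.
move=> e; rewrite HR1 HR2 !sat_fsub; split; apply: sat_ext => // j x; rewrite /interleave.
  by rewrite odd_double doubleK.
by rewrite /= odd_double /= uphalf_double.
Qed.

Lemma D0_merge R1 R2 : D0 R1 -> D0 R2 -> exists c f1 f2 E,
  [/\ delta0 f1, delta0 f2, forall j, sets (E j)
    & forall e, (R1 e <-> sat E (mix c e) f1) /\ (R2 e <-> sat E (mix c e) f2)].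
Proof.
move=> /D0_params[c1 H1] /D0_params[c2 H2]; exists (mix c2 c1).
exact: params_merge (params_l _ H1) (params_r _ H2).
Qed.

Lemma D0_ext R R' : (forall e, R e <-> R' e) -> D0 R -> D0 R'.
Proof.
move=> RR' [f [E [c [Hf HE HR]]]]; exists f, E, c; split=> // e.
by rewrite -RR'.
Qed.

Lemma D0_not R : D0 R -> D0 (fun e => ~ R e).
Proof.
by move=> [f [E [c [Hf HE HR]]]]; exists (fnot f), E, c; split=> // e; rewrite HR.
Qed.

Lemma D0_and R1 R2 : D0 R1 -> D0 R2 -> D0 (fun e => R1 e /\ R2 e).
Proof.
move=> /D0_merge H /H[c [f1 [f2 [E [H1 H2 HE HR]]]]].
exists (fand f1 f2), E, c; split; rewrite //= ?H1 // => e.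
by have := HR e; tauto.
Qed.

Lemma D0_or R1 R2 : D0 R1 -> D0 R2 -> D0 (fun e => R1 e \/ R2 e).
Proof.
move=> /D0_merge H /H[c [f1 [f2 [E [H1 H2 HE HR]]]]].
exists (for_ f1 f2), E, c; split; rewrite //= ?H1 // => e.
by have := HR e; tauto.
Qed.

Lemma D0_imp R1 R2 : D0 R1 -> D0 R2 -> D0 (fun e => R1 e -> R2 e).
Proof.
move=> /D0_merge H /H[c [f1 [f2 [E [H1 H2 HE HR]]]]].
exists (fimp f1 f2), E, c; split; rewrite //= ?H1 // => e.
by have := HR e; tauto.
Qed.

Lemma D0_iff R1 R2 : D0 R1 -> D0 R2 -> D0 (fun e => R1 e <-> R2 e).
Proof. by move=> H1 H2; apply: D0_and; apply: D0_imp. Qed.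

Lemma DT_var i : DT (fun e => e i).
Proof.
exists (tvar i.*2), (fun _ => zero N) => e.
by rewrite /= /mix odd_double doubleK.
Qed.

Lemma DT_const a : DT (fun _ => a).
Proof. by exists (tvar 1), (fun _ => a). Qed.

Lemma DT_add t u : DT t -> DT u -> DT (fun e => add (t e) (u e)).
Proof.
move=> /DT_tparams[c1 /(tparams_l _) Ht] /DT_tparams[c2 /(tparams_r _) Hu].
have [tm Etm] := Ht c2; have [um Eum] := Hu c1.
by exists (tadd tm um), (mix c2 c1) => e; rewrite Etm Eum.
Qed.

Lemma DT_mul t u : DT t -> DT u -> DT (fun e => mul (t e) (u e)).
Proof.
move=> /DT_tparams[c1 /(tparams_l _) Ht] /DT_tparams[c2 /(tparams_r _) Hu].
have [tm Etm] := Ht c2; have [um Eum] := Hu c1.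
by exists (tmul tm um), (mix c2 c1) => e; rewrite Etm Eum.
Qed.

Lemma DT_pair t u : DT t -> DT u -> DT (fun e => pair (t e) (u e)).
Proof.
by move=> Ht Hu; apply: DT_add => //; apply: DT_mul; apply: DT_add.
Qed.

Fixpoint all_DT (ts : seq (env -> N)) : Prop :=
  if ts is t :: ts' then DT t /\ all_DT ts' else True.

(* Variables beyond the listed terms are sent to zero. *)
Lemma D0_sub R ts : D0 R -> all_DT ts ->
  D0 (fun e => R (fun i => nth (fun _ => zero N) ts i e)).
Proof.
move=> /D0_params[c0 H0] Hts.
have [c [HR [tms Htms]]] : exists c, params c R /\ exists tms, forall e i,
    nth (fun _ => zero N) ts i e = eval (mix c e) (nth tzero tms i).
  elim: ts Hts => [_|t ts IHts [/DT_tparams[c1 Ht] /IHts]] /=.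
    by exists c0; split=> //; exists [::] => e i; rewrite !nth_nil.
  move=> [c [HR [tms Htms]]]; exists (mix c1 c); split; first exact: params_l.
  have [tm Etm] := tparams_r c Ht.
  exists (tm :: [seq tsub subl t | t <- tms]) => e [|i] /=; first exact: Etm.
  rewrite Htms; case: (ltnP i (size tms)) => Hi; last first.
    by rewrite !nth_default ?size_map.
  rewrite (nth_map tzero) // eval_tsub.
  by apply: eval_ext => j _; rewrite mix_subl.
have [f [E [Hf HE Hsat]]] := HR.
exists (fsub (fun i => if odd i then tvar i else nth tzero tms i./2) id f), E, c.
split; rewrite ?delta0_fsub // => e; rewrite Hsat sat_fsub.
by apply: sat_eq => i; rewrite {1}/mix Htms; case: ifP => //= Hi; rewrite /mix Hi.
Qed.

Lemma D0_sub1 (R : N -> Prop) t :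
  D0 (fun e => R (e 0)) -> DT t -> D0 (fun e => R (t e)).
Proof. by move=> HR Ht; apply: (D0_sub (ts := [:: t]) HR). Qed.

Lemma D0_sub2 (R : N -> N -> Prop) t u :
  D0 (fun e => R (e 0) (e 1)) -> DT t -> DT u -> D0 (fun e => R (t e) (u e)).
Proof. by move=> HR Ht Hu; apply: (D0_sub (ts := [:: t; u]) HR). Qed.

Lemma D0_sub3 (R : N -> N -> N -> Prop) t u v :
  D0 (fun e => R (e 0) (e 1) (e 2)) -> DT t -> DT u -> DT v ->
  D0 (fun e => R (t e) (u e) (v e)).
Proof. by move=> HR Ht Hu Hv; apply: (D0_sub (ts := [:: t; u; v]) HR). Qed.

Let sets0 := sets_inhabited N.

Lemma D0_lt t u : DT t -> DT u -> D0 (fun e => lt (t e) (u e)).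
Proof.
move=> Ht Hu; apply: (D0_sub2 (R := @lt N)) => //; have [X HX] := sets0.
by exists (flt (tvar 0) (tvar 2)), (fun _ => X), (fun _ => zero N).
Qed.

Lemma D0_eq t u : DT t -> DT u -> D0 (fun e => t e = u e).
Proof.
move=> Ht Hu; apply: (D0_sub2 (R := eq)) => //; have [X HX] := sets0.
by exists (feq (tvar 0) (tvar 2)), (fun _ => X), (fun _ => zero N).
Qed.

Lemma D0_le t u : DT t -> DT u -> D0 (fun e => le (t e) (u e)).
Proof. by move=> Ht Hu; apply: D0_or; [apply: D0_eq | apply: D0_lt]. Qed.

Lemma D0_set X t : sets X -> DT t -> D0 (fun e => X (t e)).
Proof.
move=> HX Ht; apply: (D0_sub1 (R := X)) => //.
by exists (fmem (tvar 0) 0), (fun _ => X), (fun _ => zero N).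
Qed.

(* The quantified variable of the de Bruijn predicate becomes the even variable
   [(fbound f).*2], which no other variable of [f] is renamed to. *)
Definition bind (f : formula) : formula :=
  fsub (fun i => if odd i then tvar i else
        if i is j.+2 then tvar j else tvar (fbound f).*2) id f.

Lemma sat_bind E c e a f :
  sat E (upd (mix c e) (fbound f).*2 a) (bind f) <-> sat E (mix c (scons a e)) f.
Proof.
rewrite sat_fsub; apply: sat_ext => // u /free_fbound Hu.
have Hneq w : w <= u -> w != (fbound f).*2.
  move=> wu; apply: contraTneq Hu => Ew; rewrite -leqNgt.
  by apply: leq_trans wu; rewrite Ew -addnn leq_addr.
case Ou: (odd u) => /=; first by rewrite upd_neq ?Hneq // /mix Ou.
case: u => [|[|u]] // in Hu Ou Hneq *; rewrite /= in Ou *.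
  by rewrite upd_eq.
rewrite negbK in Ou; rewrite upd_neq; first by rewrite /mix /= negbK Ou.
by apply: Hneq; apply: leq_trans (leqnSn _).
Qed.

Lemma D0_exb t (Q : N -> env -> Prop) :
  DT t -> D0 (fun e => Q (e 0) (fun i => e i.+1)) ->
  D0 (fun e => exists x, lt x (t e) /\ Q x e).
Proof.
move=> /DT_tparams[c1 Ht] /D0_params[c2 HQ].
have [tm Etm] := tparams_l c2 Ht.
have [f [E [Hf HE Hsat]]] := params_r c1 HQ.
exists (fexb (fbound f).*2 tm (bind f)), E, (mix c2 c1).
split=> //=; first by rewrite delta0_fsub.
move=> e; apply: ex_iff => a; rewrite Etm sat_bind.
by apply: and_iff => //; rewrite -Hsat.
Qed.

Lemma D0_allb t (Q : N -> env -> Prop) :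
  DT t -> D0 (fun e => Q (e 0) (fun i => e i.+1)) ->
  D0 (fun e => forall x, lt x (t e) -> Q x e).
Proof.
move=> Ht HQ.
have H := D0_not (D0_exb (Q := fun x e => ~ Q x e) Ht (D0_not HQ)).
apply: D0_ext H => e; split=> [H x xt|H [x [xt]]]; last by apply; apply: H.
by apply: NNPP => nQ; apply: H; exists x.
Qed.

End Definability.

Ltac DT_auto := repeat first
  [ assumption | apply: DT_const | apply: DT_var | apply: DT_pair
  | apply: DT_add | apply: DT_mul ].

Ltac D0_auto := cbv beta iota; repeat (first
  [ eassumption
  | apply: DT_const | apply: DT_var
  | apply: D0_exb | apply: D0_allb | apply: D0_and | apply: D0_or
  | apply: D0_not | apply: D0_iff | apply: D0_imp
  | apply: D0_lt | apply: D0_eq | apply: D0_le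
  | apply: DT_pair | apply: DT_add | apply: DT_mul
  | (apply: D0_set; [by []|])
  | (eapply D0_sub3; [eassumption|..])
  | (eapply D0_sub2; [eassumption|..])
  | (eapply D0_sub1; [eassumption|..])]; cbv beta iota).

(** * Comprehension and induction *)

Definition infinite (N : structure) (X : N -> Prop) : Prop :=
  forall a, exists b, lt a b /\ X b.

Section Induction.
Variables (N : structure) (HF : models_F N) (HI : induction_for N (Sigma 1)).
Local Notation env := (nat -> N).
Let PA : P_minus N := F_P_minus HF.
Let zenv : env := fun _ => zero N.

Lemma mix_upd0 (c e : env) a b i : mix c (scons a e) i = upd (mix c (scons b e)) 0 a i.
Proof. by rewrite /mix /upd; case: i => [|[|i]]. Qed.

Lemma D0_comprehension (P : N -> Prop) :
  D0 (fun e => P (e 0)) -> exists X, sets X /\ forall x, X x <-> P x.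
Proof.
move=> [f [E [c [Hf HE HP]]]].
have HP' x : P x <-> sat E (upd (mix c (scons (zero N) zenv)) 0 x) f.
  rewrite (HP (scons x zenv)).
  by apply: sat_eq => i; rewrite -mix_upd0.
have [X [HX Heq]] := F_comprehension HF (delta0_Sigma1 Hf) (delta0_Pi1 Hf) HE
  (fun a => iff_refl (sat E (upd (mix c (scons (zero N) zenv)) 0 a) f)).
by exists X; split=> // x; rewrite Heq HP'.
Qed.

Lemma D1_comprehension (Q Q' : N -> N -> Prop) :
  D0 (fun e => Q (e 0) (e 1)) -> D0 (fun e => Q' (e 0) (e 1)) ->
  (forall x, (exists w, Q x w) <-> (forall w, Q' x w)) ->
  exists X, sets X /\ forall x, X x <-> exists w, Q x w.
Proof.
move=> HQ HQ' QQ'.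
have [c [f [f' [E [Hf Hf' HE Hsat]]]]] := D0_merge HQ HQ'.
pose e0 := mix c (scons (zero N) (scons (zero N) zenv)).
have He x w i : mix c (scons x (scons w zenv)) i = upd (upd e0 0 x) 2 w i.
  by rewrite /e0 /mix /upd; case: i => [|[|[|[|i]]]].
have Hs x : (exists w, Q x w) <-> sat E (upd e0 0 x) (fex 2 f).
  apply: ex_iff => w; rewrite (proj1 (Hsat (scons x (scons w zenv)))).
  exact: sat_eq.
have Hp x : (forall w, Q' x w) <-> sat E (upd e0 0 x) (fall 2 f').
  apply: all_iff => w; rewrite (proj2 (Hsat (scons x (scons w zenv)))).
  exact: sat_eq.
have [|X [HX Heq]] := F_comprehension HF
  (Sigma_ex 2 (delta0_Sigma1 Hf)) (Pi_all 2 (delta0_Pi1 Hf')) HE (v := 0) (e := e0).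
  by move=> a; rewrite -Hs -Hp.
by exists X; split=> // x; rewrite Heq Hs.
Qed.

Lemma Sigma1_induction (Q : N -> N -> Prop) :
  D0 (fun e => Q (e 0) (e 1)) -> (exists w, Q (zero N) w) ->
  (forall a, (exists w, Q a w) -> exists w, Q (add a (one N)) w) ->
  forall a, exists w, Q a w.
Proof.
move=> [f [E [c [Hf HE Hsat]]]].
pose e0 := mix c (scons (zero N) (scons (zero N) zenv)).
have Hs x : (exists w, Q x w) <-> sat E (upd e0 0 x) (fex 2 f).
  apply: ex_iff => w; rewrite (Hsat (scons x (scons w zenv))).
  apply: sat_eq => i.
  by rewrite /e0 /mix /upd; case: i => [|[|[|[|i]]]].
move=> Q0 QS a; rewrite Hs.
have HS := Sigma_ex 2 (delta0_Sigma1 Hf).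
by apply: (HI HS HE) => [|b]; rewrite -!Hs //; apply: QS.
Qed.

Lemma D0_induction (P : N -> Prop) :
  D0 (fun e => P (e 0)) -> P (zero N) ->
  (forall a, P a -> P (add a (one N))) -> forall a, P a.
Proof.
move=> HP P0 PS a.
(* The trivial equation supplies a dummy witness, which brings P into the form required by
   [Sigma1_induction]. *)
have HQ : D0 (fun e : env => P (e 0) /\ e 1 = e 1) by D0_auto.
have Hex b : P b -> exists w : N, P b /\ w = w by move=> Pb; exists b.
have [||w []//] := Sigma1_induction (Q := fun x w => P x /\ w = w) HQ _ _ a.
  exact: Hex.
by move=> b [w [Pb _]]; apply/Hex/PS.
Qed.

Lemma D0_least (P : N -> Prop) x :
  D0 (fun e => P (e 0)) -> P x ->
  exists y, P y /\ forall z, lt z y -> ~ P z.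
Proof.
move=> HP Px; apply: NNPP => Hno.
suff H : forall a z, lt z a -> ~ P z by exact: H (lt_succ PA x) Px.
apply: (D0_induction (P := fun a => forall z, lt z a -> ~ P z)).
- by D0_auto.
- by move=> z /(not_lt_zero PA).
move=> a IH z /(lt_succ_iff PA)[->|]; last exact: IH.
by move=> Pa; apply: Hno; exists a.
Qed.

(* The induction is on the number of steps taken down from [k]. *)
Lemma no_infinite_descent (H : N -> Prop) (R : N -> N -> Prop) :
  sets H -> infinite H -> D0 (fun e => R (e 0) (e 1)) ->
  (forall x, H x -> exists v, R x v) ->
  (forall x x' v v', H x -> H x' -> lt x x' -> R x v -> R x' v' -> lt v' v) ->
  False.
Proof.
move=> HH Hinf HR Hex Hdesc.
have [x0 [_ Hx0]] := Hinf (zero N); have [k Rk] := Hex x0 Hx0.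
(* The inequality v + y <= k expresses, without subtraction, that y steps down from k have been made
   on the way to v. The bound u gathers the existential quantifiers over x and v into one unbounded
   witness, leaving a bounded matrix. *)
pose Q y u := exists x, lt x u /\ exists v, lt v u /\
  [/\ H x, R x v & le (add v y) k].
have HQ : D0 (fun e : env => Q (e 0) (e 1)).
  apply: (D0_ext (R := fun e => exists x, lt x (e 1) /\ exists v, lt v (e 1) /\
    (H x /\ R x v /\ le (add v (e 0)) k))); last by D0_auto.
  move=> e; apply: ex_iff => x; apply: and_iff => //; apply: ex_iff => v.
  by apply: and_iff => //; split=> [[? []]|[]].
have QI x v y : H x -> R x v -> le (add v y) k -> exists u, Q y u.
  move=> Hx Rxv le_k; have [u [xu vu]] := ltl_max PA x v.
  by exists u, x; split=> //; exists v.
have [||u [x [_ [v [_ [_ _ le_k]]]]]] :=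
  Sigma1_induction HQ _ _ (add k (one N)).
- by apply: (QI x0 k) => //; rewrite (add0 PA); left.
- move=> y [u [x [_ [v [_ [Hx Rxv le_k]]]]]].
  have [x' [xx' Hx']] := Hinf x; have [v' Rxv'] := Hex x' Hx'.
  apply: (QI x' v') => //; apply: le_trans le_k => //.
  rewrite (addC PA y) -(addA PA); apply: add_le => //; last exact: le_refl.
  exact/(lt_succ_le PA)/(Hdesc x x').
apply: (le_not_lt PA le_k); rewrite -(addA PA).
exact/(le_lt_succ PA)/(le_add_l PA).
Qed.

End Induction.

(** * Ramsey's theorem, semantically *)

Fixpoint increasing (N : structure) (H : N -> Prop) (s : seq N) : Prop :=
  if s is a :: s' then
    H a /\ (if s' is b :: _ then lt a b else True) /\ increasing H s'
  else True.

Section Ramsey.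
Variable N : structure.
Local Notation env := (nat -> N).
Implicit Types (H X : N -> Prop) (s t : seq N).
Local Notation "s `_ i" := (nth (zero N) s i).

Lemma increasingP H s : increasing H s <->
  (forall i, i < size s -> H s`_i) /\
  (forall i, i.+1 < size s -> lt s`_i s`_i.+1).
Proof.
elim: s => [|a s IHs] /=; first by split.
rewrite IHs; split=> [[Ha [Hab [Hs Hl]]]|[Hs Hl]].
  split=> -[|i] //= Hi; do ?exact: Hs; do ?exact: Hl.
  by case: (s) Hab Hi.
split; first exact: (Hs 0).
split; first by case: (s) Hl => // b s' Hl; apply: (Hl 0).
by split=> i Hi; [apply: (Hs i.+1) | apply: (Hl i.+1)].
Qed.

Lemma sat_fincreasing E (e : env) v d :
  sat E e (fincreasing_in_S v d) <-> increasing (E 1) [seq e i | i <- iota v d].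
Proof.
rewrite increasingP /fincreasing_in_S [sat _ _ _]/= !sat_fconj size_map size_iota.
have nth_e i : i < d -> [seq e j | j <- iota v d]`_i = e (v + i).
  by move=> Hi; rewrite (nth_map 0) ?size_iota // nth_iota.
split=> -[Hs Hl]; split=> i.
- by move=> Hi; rewrite nth_e //; apply: Hs; rewrite mem_iota leq_addr ltn_add2l.
- move=> Hi; rewrite !nth_e ?(ltnW Hi) // addnS; apply: Hl.
  by rewrite mem_iota leq_addr ltn_add2l; case: (d) Hi.
- rewrite mem_iota => /andP[/subnKC <-]; rewrite ltn_add2l => Hi.
  by have := Hs _ Hi; rewrite nth_e.
- rewrite mem_iota => /andP[/subnKC <-]; rewrite ltn_add2l => Hi.
  have {}Hi : (i - v).+1 < d by case: (d) Hi.
  by have := Hl _ Hi; rewrite !nth_e ?(ltnW Hi) // addnS.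
Qed.

Definition code s : N := if s is a :: s' then tuple a s' else zero N.

Lemma eval_fcolor1 E (e : env) v d :
  sat E e (fcolor1 v d.+1) <->
  E 0 (pair (num N 1) (code [seq e i | i <- iota v d.+1])).
Proof.
rewrite /fcolor1 /fcol [sat _ _ _]/= -/(tpair _ _).
by rewrite -[add _ _]/(eval e (tpair (tnum 1) (ttuple _ _))) eval_tpair
  eval_ttuple eval_tnum -map_comp.
Qed.

Lemma increasing_extend H b k : infinite H -> H b ->
  exists s, size s = k /\ increasing H (b :: s).
Proof.
move=> Hinf; elim: k b => [|k IHk] b Hb; first by exists [::].
have [c [bc Hc]] := Hinf b; have [s [Hs Hcs]] := IHk c Hc.
by exists (c :: s); split; rewrite /= ?Hs.
Qed.

Lemma sat_finfinite E (e : env) (A : term -> formula) P :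
  (forall e, sat E e (A (tvar 1)) <-> P (e 1)) ->
  sat E e (finfinite A) <-> infinite P.
Proof.
move=> HA; apply: all_iff => a; apply: ex_iff => b.
by apply: and_iff; [ | exact: HA].
Qed.

(** Here d is the length of the tail, so this is homogeneity for (d + 1)-tuples. *)
Definition homogeneous d (I H : N -> Prop) : Prop :=
  forall a b s t, size s = d -> size t = d ->
    increasing H (a :: s) -> increasing H (b :: t) ->
    (I (pair (num N 1) (tuple a s)) <-> I (pair (num N 1) (tuple b t))).

Lemma holds_RT2 d (I H : N -> Prop) : holds (RT2 d.+1) I H ->
  infinite (fun i => I (pair (num N 0) i)) ->
  [/\ infinite H, forall x, H x -> I (pair (num N 0) x) & homogeneous d I H].
Proof.
have Einst : sat (set_env [:: I; H]) (num_env [::]) (inst (RT2 d.+1)) <->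
    infinite (fun i => I (pair (num N 0) i)) by exact: sat_finfinite.
move=> /holdsE[[_]|[Hinst _] Iinf]; last by case: Hinst; apply/Einst.
rewrite /sol /RT2 => /sat_fconj3[HS Hcol /sat_falls Hhom] _.
have {}HS : infinite H := HS.
(* The solution formula quantifies over both tuples in one block: the first d + 1 variables receive
   [a :: s], the next d + 1 receive [b :: t]. *)
split=> // a b s t Es Et Hs Ht; set u := a :: s ++ b :: t.
have size_u : size u = d.+1 + d.+1 by rewrite /= size_cat /= Es Et.
have Eu1 : [seq u`_i | i <- iota 0 d.+1] = a :: s.
  by rewrite map_nth_iota ?size_u ?leq_addr // drop0 -Es /u -cat_cons take_size_cat.
have Eu2 : [seq u`_i | i <- iota d.+1 d.+1] = b :: t.
  rewrite map_nth_iota ?size_u ?addnK // -Es /u -cat_cons drop_size_cat //.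
  by rewrite take_oversize //= Et Es.
have := Hhom (fun i => u`_i); rewrite sat_fimp sat_fand sat_fiff.
rewrite !sat_fincreasing !eval_fcolor1 Eu1 Eu2; apply=> //.
move=> i; rewrite mem_iota -leqNgt => Hi; rewrite nth_default ?size_u //.
by rewrite /num_env nth_nil.
Qed.

End Ramsey.

(** * Arithmetical comprehension from triples *)

Section Comprehension.
Variables (N : structure) (HF : models_F N) (HI : induction_for N (Sigma 1)).
Variables (d : nat) (HR : realizes N (RT2 d.+3)).
Local Notation env := (nat -> N).
Let PA : P_minus N := F_P_minus HF.

(** A (d + 3)-tuple is given the color of its first three entries. Every triple of an infinite
    homogeneous set extends to such a tuple within the set, so homogeneity descends to triples. *)
Lemma ramsey_triples (X : N -> Prop) (C : N -> N -> N -> Prop) :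
  sets X -> infinite X -> D0 (fun e => C (e 0) (e 1) (e 2)) ->
  exists H, [/\ sets H, infinite H, forall x, H x -> X x &
    forall a b c a' b' c', increasing H [:: a; b; c] ->
      increasing H [:: a'; b'; c'] -> (C a b c <-> C a' b' c')].
Proof.
move=> HX Xinf HC.
(* [T] recovers the third entry c from the code w of the tail starting at c. If d = 0 the code is c
   itself; otherwise it is a pair <c, y>, and no condition is put on the form of y because every
   number codes a tuple of length one. *)
pose T (c w z : N) := if d is 0 then w = c else exists y, lt y z /\ w = pair c y.
(* Components of a pair are at most its code, so the bound z + 1 loses nothing and the instance is
   given by a bounded formula. *)
pose V z := (exists i, lt i (add z (one N)) /\ (z = pair (num N 0) i /\ X i)) \/
  exists a, lt a (add z (one N)) /\ exists b, lt b (add z (one N)) /\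
  exists c, lt c (add z (one N)) /\ exists w, lt w (add z (one N)) /\
    (z = pair (num N 1) (pair a (pair b w)) /\
     (T c w (add z (one N)) /\ C a b c)).
have HT : D0 (fun e : env => T (e 0) (e 1) (e 2)).
  by rewrite /T; case: (d) => [|_]; D0_auto.
have HV : D0 (fun e : env => V (e 0)) by rewrite /V; D0_auto.
have [I [HI' IV]] := D0_comprehension HF HV.
have num01 : num N 0 <> num N 1 by move/(num_inj PA).
have I0 x : I (pair (num N 0) x) <-> X x.
  rewrite IV; split=> [[[i [_ [/(pair_inj PA)[_ ->]]]] //|]|Xx].
    by move=> [a [_ [b [_ [c [_ [w [_ [/(pair_inj PA)[/num01]]]]]]]]]].
  left; exists x; split=> //; exact/(le_lt_succ PA)/(le_pair_r PA).
have T_tuple c s z : size s = d ->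
    (forall x, le x (tuple c s) -> lt x z) -> T c (tuple c s) z.
  rewrite /T; case: (d) s => [|d'] [|y s] //= _ Hz.
  by exists (tuple y s); split=> //; apply/Hz/(le_pair_r PA).
have I1 a b c s : size s = d ->
    I (pair (num N 1) (tuple a (b :: c :: s))) <-> C a b c.
  move=> Es; rewrite IV; split.
    case=> [[i [_ [/(pair_inj PA)[/esym/num01]]]] //|].
    move=> [a' [_ [b' [_ [c' [_ [w [_ []]]]]]]]].
    move=> /(pair_inj PA)[_ /(pair_inj PA)[-> /(pair_inj PA)[-> <-]]] [].
    rewrite /T; case: (d) s Es => [|d'] [|y s] //= _; first by move=> ->.
    by move=> [y' [_ /(pair_inj PA)[-> _]]].
  move=> Cabc; right; set z := pair _ _.
  have lt_z x : le x (pair b (tuple c s)) -> lt x (add z (one N)).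
    move=> Hx; apply/(le_lt_succ PA).
    by do 2![apply: (le_trans PA _ (le_pair_r PA _ _))].
  have lt_w x : le x (tuple c s) -> lt x (add z (one N)).
    by move=> Hx; apply/lt_z/(le_trans PA Hx)/(le_pair_r PA).
  exists a; split.
    apply/(le_lt_succ PA).
    exact: (le_trans PA (le_pair_l PA _ _) (le_pair_r PA _ _)).
  exists b; split; first exact/lt_z/(le_pair_l PA).
  exists c; split; first exact/lt_w/(le_tuple_head PA).
  exists (tuple c s); split; first exact/lt_w/le_refl.
  by split=> //; split=> //; apply: T_tuple.
have Iinf : infinite (fun i => I (pair (num N 0) i)).
  by move=> a; have [b [ab Xb]] := Xinf a; exists b; split=> //; apply/I0.
have [H [HH Hsol]] := HR HI'.
have [Hinf HcX Hhom] := holds_RT2 Hsol Iinf.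
exists H; split=> // [x /HcX/I0 //|a b c a' b' c' Habc Habc'].
have ext x y z : increasing H [:: x; y; z] ->
    exists s, size s = d /\ increasing H [:: x, y, z & s].
  move=> Hxyz; have Hz : H z by case: Hxyz => _ [_ [_ [_ []]]].
  have [s [Es Hs]] := increasing_extend d Hinf Hz.
  by exists s; split=> //; move: Hxyz => /= [? [? [? [? _]]]].
have [s [Es Hs]] := ext _ _ _ Habc; have [t [Et Ht]] := ext _ _ _ Habc'.
by rewrite -(I1 _ _ _ s) // -(I1 _ _ _ t) //; apply: Hhom; rewrite /= ?Es ?Et.
Qed.

(* By Ramsey's theorem for pairs, the least values v < k of R are monotone on an
   infinite set; then v or k - v descends infinitely. *)
Lemma infinite_pigeonhole (X : N -> Prop) (R : N -> N -> Prop) k :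
  sets X -> infinite X -> D0 (fun e => R (e 0) (e 1)) ->
  (forall x, X x -> exists v, lt v k /\ R x v) ->
  (forall x x' v, X x -> X x' -> lt v k -> R x v -> R x' v -> x = x') -> False.
Proof.
move=> HX Xinf Rdef Rex Rinj.
pose G x v := [/\ lt v k, R x v & forall u, lt u v -> ~ R x u].
have Gdef : D0 (fun e : env => G (e 0) (e 1)).
  apply: (D0_ext (R := fun e => lt (e 1) k /\ (R (e 0) (e 1) /\
    forall u, lt u (e 1) -> ~ R (e 0) u))); last by D0_auto.
  by move=> e; split=> [[? []]|[]].
have Gex x : X x -> exists v, G x v.
  move=> /Rex[v [vk Rxv]].
  have Rxdef : D0 (fun e : env => R x (e 0)) by D0_auto.
  have [u [Rxu Hu]] := D0_least HF HI Rxdef Rxv.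
  exists u; split=> //; apply: (le_lt_trans PA _ vk).
  by apply: (not_lt_le PA) => /Hu.
have Gfun x u v : G x u -> G x v -> u = v.
  move=> [_ Rxu Hu] [_ Rxv Hv]; case: (lt_total PA u v) => [/Hv|[|/Hu]] //.
(* Ramsey's theorem for pairs is obtained from triples by a color that ignores the last entry: color
   1 means that least values increase. *)
pose C a b (_ : N) := exists v, lt v k /\ exists u, lt u v /\ (G a u /\ G b v).
have Cdef : D0 (fun e : env => C (e 0) (e 1) (e 2)) by rewrite /C; D0_auto.
have [H [HH Hinf HX' Hhom]] := ramsey_triples HX Xinf Cdef.
have ext x y : H x -> H y -> lt x y -> exists z, increasing H [:: x; y; z].
  by move=> Hx Hy xy; have [z [yz Hz]] := Hinf y; exists z.
have [x0 [_ Hx0]] := Hinf (zero N); have [y0 [xy0 Hy0]] := Hinf x0.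
have [z0 Hxyz0] := ext _ _ Hx0 Hy0 xy0.
case: (classic (C x0 y0 z0)) => C0.
  pose R' x v := exists u, lt u k /\ (add u v = k /\ G x u).
  apply: (no_infinite_descent HF HI (R := R') HH Hinf).
  - by rewrite /R'; D0_auto.
  - move=> x Hx; have [u Gxu] := Gex x (HX' x Hx).
    have uk : lt u k by case: Gxu.
    by have [v Ev] := lt_sub PA uk; exists v, u.
  move=> x y v w Hx Hy xy [u [_ [Eu Gxu]]] [u' [_ [Eu' Gyu']]].
  have [z Hxyz] := ext _ _ Hx Hy xy.
  have [b [_ [a [ab [Gxa Gyb]]]]] := iffLR (Hhom _ _ _ _ _ _ Hxyz0 Hxyz) C0.
  move: ab; rewrite (Gfun _ _ _ Gxa Gxu) (Gfun _ _ _ Gyb Gyu') => uu'.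
  apply: NNPP => /(not_lt_le PA) vw.
  apply: (lt_irr PA (x := k)); rewrite -{1}Eu -Eu'.
  apply: (lt_le_trans PA (lt_add PA v uu')).
  exact: (add_le PA (le_refl _) vw).
apply: (no_infinite_descent HF HI (R := G) HH Hinf Gdef).
  by move=> x /HX'/Gex.
(* Color 0 only says that least values do not increase; equal values are excluded by [Rinj], because
   x < y. So the values themselves descend. *)
move=> x y u v Hx Hy xy Gxu Gyv; apply: NNPP => /(not_lt_le PA)[Euv|uv].
  apply: (lt_irr PA (x := x)).
  case: Gxu Gyv => [uk Rxu _] [_ + _]; rewrite -Euv => Ryu.
  by rewrite {2}(Rinj x y u (HX' x Hx) (HX' y Hy) uk Rxu Ryu).
have [z Hxyz] := ext _ _ Hx Hy xy.
apply/C0/(Hhom _ _ _ _ _ _ Hxyz0 Hxyz).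
by exists v; split; [case: Gyv | exists u].
Qed.

(* If no bound exists then infinitely many numbers are least witnesses of some
   [p < a], and mapping such a number to [p] contradicts the pigeonhole
   principle. *)
Lemma strong_collection (T : N -> N -> Prop) a :
  D0 (fun e => T (e 0) (e 1)) ->
  exists b, forall p, lt p a -> (exists w, T p w) -> exists w, lt w b /\ T p w.
Proof.
move=> Tdef.
pose R w p := T p w /\ forall u, lt u w -> ~ T p u.
have Rdef : D0 (fun e : env => R (e 0) (e 1)) by rewrite /R; D0_auto.
pose G w := exists p, lt p a /\ R w p.
have Gdef : D0 (fun e : env => G (e 0)) by rewrite /G; D0_auto.
have [X [HX XG]] := D0_comprehension HF Gdef.
case: (classic (infinite X)) => [Xinf|].
  case: (infinite_pigeonhole (k := a) HX Xinf Rdef) => [x /XG //|].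
  move=> x y p _ _ _ [Tx Hx] [Ty Hy].
  by case: (lt_total PA x y) => [/Hy|[|/Hx]].
move=> /not_all_ex_not[b Hb]; exists (add b (one N)) => p pa [w Tpw].
have Tpdef : D0 (fun e : env => T p (e 0)) by D0_auto.
have [v [Tpv Hv]] := D0_least HF HI Tpdef Tpw.
exists v; split=> //; apply/(le_lt_succ PA)/(not_lt_le PA) => bv.
by apply: Hb; exists v; split=> //; apply/XG; exists p.
Qed.

(** For a < b in the homogeneous set and p < a, a witness for p exists iff one exists below b.
    Searching the set for such a and b therefore decides the Sigma^0_1 predicate. *)
Lemma Sigma1_comprehension (T : N -> N -> Prop) :
  D0 (fun e => T (e 0) (e 1)) ->
  exists X, sets X /\ forall p, X p <-> exists w, T p w.
Proof.
move=> Tdef.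
pose C a b c := forall p, lt p a ->
  (exists w, lt w c /\ T p w) -> exists w, lt w b /\ T p w.
have Cdef : D0 (fun e : env => C (e 0) (e 1) (e 2)) by rewrite /C; D0_auto.
have Udef : D0 (fun e : env => e 0 = e 0) by D0_auto.
have [U [HU Uall]] := D0_comprehension HF (P := fun x => x = x) Udef.
have Uinf : infinite U.
  by move=> a; exists (add a (one N)); split; [apply: lt_succ | apply/Uall].
have [H [HH Hinf _ Hhom]] := ramsey_triples HU Uinf Cdef.
(* One triple of color 1 suffices for all of them. It is found by taking b' beyond the bound that
   [strong_collection] gives for a: every p < a with any witness has one below b'. *)
have CH a b c : increasing H [:: a; b; c] -> C a b c.
  move=> Habc; have [Ha _] := Habc.
  have [b0 Hb0] := strong_collection a Tdef.
  have [b1 [bb1 ab1]] := ltl_max PA b0 a.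
  have [b' [bb' Hb']] := Hinf b1; have [c' [bc' Hc']] := Hinf b'.
  apply/(Hhom a b' c') => //.
    have ab' := lt_trans PA ab1 bb'.
    by do ![split=> //].
  move=> p pa [w [_ Tpw]]; have [v [vb Tpv]] := Hb0 p pa (ex_intro _ w Tpw).
  exists v; split=> //.
  exact: (lt_trans PA vb (lt_trans PA bb1 bb')).
(* These are the Sigma^0_1 and Pi^0_1 definitions of the same set: some pair a < b of H above p, or
   every such pair, has a witness for p below b. *)
pose Q p z := exists a, lt a z /\ exists b, lt b z /\ exists w, lt w b /\
  (H a /\ H b /\ lt p a /\ lt a b /\ T p w).
pose Q' p z := forall a, lt a z -> forall b, lt b z ->
  H a /\ H b /\ lt p a /\ lt a b -> exists w, lt w b /\ T p w.
have Qdef : D0 (fun e : env => Q (e 0) (e 1)) by rewrite /Q; D0_auto.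
have Qdef' : D0 (fun e : env => Q' (e 0) (e 1)) by rewrite /Q'; D0_auto.
have Q1 p : (exists w, T p w) -> forall z, Q' p z.
  move=> [w Tpw] z a _ b _ [Ha [Hb [pa ab]]].
  have [c0 [wc0 bc0]] := ltl_max PA w b; have [c [cc0 Hc]] := Hinf c0.
  apply: (CH a b c _ p pa); last first.
    by exists w; split=> //; apply: (lt_trans PA wc0 cc0).
  have bc := lt_trans PA bc0 cc0.
  by do ![split=> //].
have Q2 p : (forall z, Q' p z) -> exists z, Q p z.
  move=> HQ; have [a [pa Ha]] := Hinf p; have [b [ab Hb]] := Hinf a.
  have [z [az bz]] := ltl_max PA a b.
  have [w [wb Tpw]] : exists w, lt w b /\ T p w by apply: (HQ z a az b bz).
  by exists z, a; split=> //; exists b; split=> //; exists w.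
have Q3 p : (exists z, Q p z) -> exists w, T p w.
  by move=> [z [a [_ [b [_ [w [_ [_ [_ [_ [_ Tpw]]]]]]]]]]]; exists w.
have [|X [HX XQ]] := D1_comprehension HF Qdef Qdef'.
  by move=> p; split=> [/Q3/Q1|/Q2].
by exists X; split=> // p; rewrite XQ; split=> [/Q3|/Q1/Q2].
Qed.

End Comprehension.

(** * Absorbing number quantifiers into set parameters *)

Section Arithmetical.
Variables (N : structure) (HF : models_F N) (HI : induction_for N (Sigma 1)).
Variables (d : nat) (HR : realizes N (RT2 d.+3)).
Local Notation env := (nat -> N).
Let PA : P_minus N := F_P_minus HF.

Lemma sat_interleave_l E1 E2 (e : env) f :
  sat (interleave E1 E2) e (fsub tvar (fun j => j.*2) f) <-> sat E1 e f.
Proof.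
rewrite sat_fsub; apply: sat_ext => // j x.
by rewrite /interleave odd_double doubleK.
Qed.

Lemma sat_interleave_r E1 E2 (e : env) f :
  sat (interleave E1 E2) e (fsub tvar (fun j => j.*2.+1) f) <-> sat E2 e f.
Proof.
rewrite sat_fsub; apply: sat_ext => // j x.
by rewrite /interleave /= odd_double /= uphalf_double.
Qed.

Lemma sat_upd2_D0 f E (e0 : env) i j :
  delta0 f -> (forall j, sets (E j)) ->
  D0 (fun e => sat E (upd (upd e0 i (e 0)) j (e 1)) f).
Proof.
move=> Hf HE; exists (fsub (fun k => if k == j then tvar 2 else
  if k == i then tvar 0 else tvar k.*2.+1) id f), E, e0.
split; rewrite ?delta0_fsub // => e; rewrite sat_fsub; apply: sat_eq => k.
rewrite /upd; case: eqP => //; case: eqP => //= _ _.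
by rewrite /mix /= odd_double /= uphalf_double.
Qed.

Lemma map_iota_inj (e e' : env) m :
  [seq e i | i <- iota 0 m] = [seq e' i | i <- iota 0 m] ->
  forall i, i < m -> e i = e' i.
Proof.
move=> /eq_in_map H i im.
by apply: H; rewrite mem_iota add0n.
Qed.

Definition fcode (m : nat) : term := ttuple (tvar 0) [seq tvar i | i <- iota 1 m].

Lemma eval_fcode (e : env) m :
  eval e (fcode m) = tuple (e 0) [seq e i | i <- iota 1 m].
Proof. by rewrite eval_ttuple -map_comp. Qed.

Lemma occurs_succ_var v w : v != w -> ~~ occurs v (tadd (tvar w) tone).
Proof. by move=> vw /=; rewrite orbF. Qed.

Lemma fcode_inj (e e' : env) m : eval e (fcode m) = eval e' (fcode m) ->
  forall i, i < m.+1 -> e i = e' i.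
Proof.
rewrite !eval_fcode => /(tuple_inj PA)[|E0 E1]; first by rewrite !size_map.
by apply: map_iota_inj; rewrite /= E0 E1.
Qed.

Lemma le_fcode (e : env) m i : i < m.+1 -> le (e i) (eval e (fcode m)).
Proof.
move=> Hi; rewrite eval_fcode.
have := @le_tuple_nth _ PA (e 0) [seq e i | i <- iota 1 m] i.
rewrite size_map size_iota => /(_ Hi).
rewrite -[e 0 :: _]/[seq e i | i <- iota 0 m.+1].
by rewrite (nth_map 0) ?size_iota // nth_iota.
Qed.

(** The codes of the assignments satisfying [fex v f] form a set Y by [Sigma1_comprehension];
    membership of [fcode m] in Y is then an atomic formula that replaces the quantified one. *)
Lemma fex_elim f E v : delta0 f -> (forall j, sets (E j)) ->
  exists f' E', [/\ delta0 f', forall j, sets (E' j)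
    & forall e : env, sat E e (fex v f) <-> sat E' e f'].
Proof.
move=> Hf HE.
have [m Em] : exists m, m.+1 = fbound (fex v f).
  by exists (fbound (fex v f)).-1; rewrite prednK //= leq_max.
have vm : v < m.+1 by rewrite Em /= leq_max leqnn.
have mv : m.+2 != v by rewrite neq_ltn (leqW vm) orbT.
have fm : fbound f <= m.+1 by rewrite Em /= leq_max leqnn orbT.
(* Variable m + 1 holds the code p of an assignment and variable m + 2 a proposed witness. Decoding
   is a bounded search since entries are at most p. The bounded quantifier over v with v = w merely
   assigns the witness to v. *)
pose g := fexbs (iota 0 m.+1) (tadd (tvar m.+1) tone)
  (fand (feq (tvar m.+1) (fcode m)) (fexb v (tadd (tvar m.+2) tone)
    (fand (feq (tvar v) (tvar m.+2)) f))).
have Hg : delta0 g by rewrite delta0_fexbs.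
pose env2 p w : env := upd (upd (fun _ => zero N) m.+1 p) m.+2 w.
have [Y [HY Yex]] := Sigma1_comprehension HF HI HR
  (T := fun p w => sat E (env2 p w) g) (sat_upd2_D0 _ _ _ Hg HE).
exists (fmem (fcode m) 0), (fun _ => Y); split=> // e.
rewrite -[sat _ _ (fmem _ _)]/(Y (eval e (fcode m))) Yex.
have Hocc : {in iota 0 m.+1, forall v, ~~ occurs v (tadd (tvar m.+1) tone)}.
  move=> i; rewrite mem_iota => /andP[_ Hi].
  by apply: occurs_succ_var; rewrite neq_ltn Hi.
apply: ex_iff => w; rewrite sat_fexbs //.
have env2_p p : env2 p w m.+1 = p.
  by rewrite /env2 upd_neq ?upd_eq // neq_ltn ltnSn.
have env2_w p : env2 p w m.+2 = w by rewrite /env2 upd_eq.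
have off e' p i : m < i -> agree_off (iota 0 m.+1) (env2 p w) e' -> e' i = env2 p w i.
  by move=> mi; apply; rewrite mem_iota add0n -leqNgt.
have satf e' : (forall i, i < m.+1 -> e' i = e i) ->
    sat E (upd e' v w) f <-> sat E (upd e v w) f.
  move=> He; apply: sat_ext => // i /free_fbound Hi; rewrite /upd.
  by case: eqP => // _; apply: He; apply: leq_trans Hi fm.
split=> [Hw|[e' [He' _]]].
  pose e' i := if i < m.+1 then e i else env2 (eval e (fcode m)) w i.
  have Ee' i : i < m.+1 -> e' i = e i by rewrite /e' => ->.
  have Ecode : eval e' (fcode m) = eval e (fcode m).
    rewrite !eval_fcode Ee' //; congr tuple; apply/eq_in_map => i.
    by rewrite mem_iota => /andP[_]; rewrite add1n => /Ee'.
  have Ep : e' m.+1 = eval e (fcode m) by rewrite /e' ltnn env2_p.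
  have Ew : e' m.+2 = w by rewrite /e' ltnNge leqnSn /= env2_w.
  exists e'; split.
  - by move=> i; rewrite mem_iota add0n leq0n /= /e' => /negbTE ->.
  - move=> i; rewrite mem_iota add0n => /= Hi; rewrite env2_p Ee' //.
    exact/(le_lt_succ PA)/le_fcode.
  - split; first exact: (etrans Ep (esym Ecode)).
    exists w; rewrite /= Ew; split; first exact: lt_succ.
    rewrite upd_eq upd_neq ?Ew //.
    by split=> //; apply/satf.
move=> [Ecode [a [_ [Ea Hsat]]]].
have Ep : e' m.+1 = eval e (fcode m) by rewrite (off _ _ _ _ He') ?env2_p.
have Ew : e' m.+2 = w by rewrite (off _ _ _ _ He').
have Ea' : a = w by move: Ea; rewrite /= upd_eq upd_neq // Ew.
move: Hsat; rewrite Ea' => /satf; apply=> i Hi.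
by apply: (fcode_inj (m := m)) Hi; rewrite -Ep -Ecode.
Qed.

(** Induction on the formula, with a fresh set parameter at each unbounded quantifier; a universal
    one is treated as a negated existential. The set assignments of two subformulas are
    interleaved. *)
Lemma formula_delta0 f E : (forall j, sets (E j)) ->
  exists f' E', [/\ delta0 f', forall j, sets (E' j)
    & forall e : env, sat E e f <-> sat E' e f'].
Proof.
move=> HE; elim: f => //=.
- by move=> t u; exists (feq t u), E.
- by move=> t u; exists (flt t u), E.
- by move=> t u; exists (fmem t u), E.
- by move=> f [f' [E' [Hf' HE' H]]]; exists (fnot f'), E'; split=> // e; rewrite H.
- move=> f [f' [E1 [Hf' HE1 H1]]] g [g' [E2 [Hg' HE2 H2]]].
  exists (fand (fsub tvar (fun j => j.*2) f') (fsub tvar (fun j => j.*2.+1) g')),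
    (interleave E1 E2); split=> [|j|e].
  + by rewrite /= !delta0_fsub Hf'.
  + by rewrite /interleave; case: ifP.
  by rewrite sat_fand sat_interleave_l sat_interleave_r H1 H2.
- move=> f [f' [E1 [Hf' HE1 H1]]] g [g' [E2 [Hg' HE2 H2]]].
  exists (for_ (fsub tvar (fun j => j.*2) f') (fsub tvar (fun j => j.*2.+1) g')),
    (interleave E1 E2); split=> [|j|e].
  + by rewrite /= !delta0_fsub Hf'.
  + by rewrite /interleave; case: ifP.
  by rewrite [sat (interleave _ _) _ _]/= sat_interleave_l sat_interleave_r H1 H2.
- move=> f [f' [E1 [Hf' HE1 H1]]] g [g' [E2 [Hg' HE2 H2]]].
  exists (fimp (fsub tvar (fun j => j.*2) f') (fsub tvar (fun j => j.*2.+1) g')),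
    (interleave E1 E2); split=> [|j|e].
  + by rewrite /= !delta0_fsub Hf'.
  + by rewrite /interleave; case: ifP.
  by rewrite sat_fimp sat_interleave_l sat_interleave_r H1 H2.
- move=> v f [f' [E' [Hf' HE' H]]].
  have [g [E2 [Hg HE2 H2]]] := @fex_elim (fnot f') E' v Hf' HE'.
  exists (fnot g), E2; split=> // e; rewrite [sat _ _ (fnot g)]/= -H2.
  split=> [Hall [a]|Hno a]; first by apply; apply/H.
  by apply: NNPP => Hn; apply: Hno; exists a => /H.
- move=> v f [f' [E' [Hf' HE' H]]].
  have [g [E2 [Hg HE2 H2]]] := @fex_elim f' E' v Hf' HE'.
  exists g, E2; split=> // e; rewrite -H2; apply: ex_iff => a; exact: H.
- move=> v t f [f' [E' [Hf' HE' H]]]; exists (fallb v t f'), E'; split=> // e.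
  by apply: all_iff => a; apply: imp_iff; [|exact: H].
- move=> v t f [f' [E' [Hf' HE' H]]]; exists (fexb v t f'), E'; split=> // e.
  by apply: ex_iff => a; apply: and_iff; [|exact: H].
Qed.

(** Through this, pigeonhole and collection, proved for [D0] relations, become available for
    arbitrary arithmetical ones. *)
Lemma sat_upd2_arith f E (e0 : env) i j : (forall j, sets (E j)) ->
  D0 (fun e => sat E (upd (upd e0 i (e 0)) j (e 1)) f).
Proof.
move=> HE; have [f' [E' [Hf' HE' H]]] := formula_delta0 f HE.
apply: D0_ext (sat_upd2_D0 e0 i j Hf' HE') => e; split=> Hs; exact/H.
Qed.

End Arithmetical.

(** * Bounded forms of Sigma_m and Pi_m formulas *)

(* [Q] holds of all (z_1, .., z_m) with z_1 large enough, z_2 large enough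
   depending on z_1, and so on. *)
Fixpoint far (N : structure) (m : nat) (Q : seq N -> Prop) : Prop :=
  if m is m'.+1 then exists b, forall z, lt b z -> far m' (fun s => Q (z :: s))
  else Q [::].

Definition override (N : structure) (B : nat) (e : nat -> N) (zs : seq N) :
    nat -> N :=
  fun i => if i < B then e i else nth (zero N) zs (i - B).

(* [g] is a bounded form of [h], the bounds of the m blocks of quantifiers being
   the variables B, .., B + m - 1: it agrees with [h] for all far bounds,
   uniformly in values below [a] of the variables of [h], which are less than M. *)
Definition bounded_form (N : structure) (m M : nat) (h : formula) (B : nat)
    (g : formula) : Prop :=
  delta0 g /\ (forall v, free v g -> v < B + m) /\
  forall E : nat -> N -> Prop, (forall j, sets (E j)) -> forall a : N,
    far m (fun zs => forall e : nat -> N, (forall i, i < M -> lt (e i) a) ->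
      (sat E (override B e zs) g <-> sat E e h)).

Lemma fbound_fexs vs h M : fbound (fexs vs h) <= M ->
  {in vs, forall v, v < M} /\ fbound h <= M.
Proof.
elim: vs => //= v vs IHvs; rewrite geq_max => /andP[vM /IHvs[vsM ->]].
by split=> // u; rewrite inE => /orP[/eqP -> //|/vsM].
Qed.

Lemma free_fexbs v vs t f : free v (fexbs vs t f) -> occurs v t || free v f.
Proof.
elim: vs => /= [->|w vs IHvs]; first by rewrite orbT.
by move=> /orP[-> //|/andP[_ /IHvs]].
Qed.

Section Far.
Variables (N : structure) (HF : models_F N) (HI : induction_for N (Sigma 1)).
Variables (d : nat) (HR : realizes N (RT2 d.+3)).
Local Notation env := (nat -> N).
Let PA : P_minus N := F_P_minus HF.

Lemma far_mono m (Q Q' : seq N -> Prop) :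
  (forall s, size s = m -> Q s -> Q' s) -> far m Q -> far m Q'.
Proof.
elim: m Q Q' => [|m IHm] Q Q' QQ' /=; first exact: QQ'.
move=> [b Hb]; exists b => z /Hb; apply: IHm => s Es.
by apply: QQ'; rewrite /= Es.
Qed.

Lemma far_and m (Q Q' : seq N -> Prop) :
  far m Q -> far m Q' -> far m (fun s => Q s /\ Q' s).
Proof.
elim: m Q Q' => [|m IHm] Q Q' //= [b Hb] [b' Hb'].
have [c [bc bc']] := ltl_max PA b b'; exists c => z cz.
by apply: IHm; [apply/Hb/(lt_trans PA bc) | apply/Hb'/(lt_trans PA bc')].
Qed.

Lemma far_take m (Q : seq N -> Prop) :
  far m Q -> far m.+1 (fun s => Q (take m s)).
Proof.
elim: m Q => [|m IHm] Q; first by exists (zero N) => z _ /=.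
by case=> b Hb; exists b => z /Hb/IHm; apply: far_mono.
Qed.

(** Each threshold depends only on the entries already chosen, and an infinite set has elements
    beyond any threshold. *)
Lemma far_increasing m (Q : seq N -> Prop) H y : infinite H -> H y -> far m Q ->
  exists s, [/\ size s = m, increasing H (y :: s) & Q s].
Proof.
move=> Hinf; elim: m Q y => [|m IHm] Q y Hy; first by exists [::].
case=> b Hb; have [c [bc yc]] := ltl_max PA b y; have [z [cz Hz]] := Hinf c.
have [s [Es Hs Qs]] := IHm _ z Hz (Hb z (lt_trans PA bc cz)).
exists (z :: s); split; rewrite ?[size _]/= ?Es //.
by split=> //; split=> //; apply: lt_trans cz.
Qed.

Lemma finite_bound (vs : seq nat) (e : env) :
  exists w, {in vs, forall i, lt (e i) w}.
Proof.
elim: vs => [|v vs [w Hw]]; first by exists (zero N).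
have [w' [ww' vw']] := ltl_max PA w (e v); exists w' => i.
by rewrite inE => /orP[/eqP -> //|/Hw]; move/(lt_trans PA)/(_ ww').
Qed.

(** Assignments with values below a have codes below a common bound, so [strong_collection] applies
    to codes. What is collected is not the witnesses of the block but a number w above all of
    them. *)
Lemma block_bound vs h M E a : {in vs, forall v, v < M} -> fbound h <= M ->
  (forall j, sets (E j)) ->
  exists b, forall e : env, (forall i, i < M -> lt (e i) a) ->
    sat E e (fexs vs h) ->
    exists e', [/\ agree_off vs e e', {in vs, forall i, lt (e' i) b}
                 & sat E e' h].
Proof.
move=> vsM hM HE.
pose g := fexs (iota 0 M.+1)
  (fand (feq (tvar M.+1) (fcode M)) (fexbs vs (tvar M.+2) h)).
pose env2 p w : env := upd (upd (fun _ => zero N) M.+1 p) M.+2 w.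
have env2_p p w : env2 p w M.+1 = p.
  by rewrite /env2 upd_neq ?upd_eq // neq_ltn ltnSn.
have env2_w p w : env2 p w M.+2 = w by rewrite /env2 upd_eq.
have off e' p w i : M < i -> agree_off (iota 0 M.+1) (env2 p w) e' ->
    e' i = env2 p w i.
  by move=> mi; apply; rewrite mem_iota add0n -leqNgt.
have Hocc : {in vs, forall v, ~~ occurs v (tvar M.+2)}.
  by move=> v /vsM vM; rewrite /= neq_ltn ltnW // ltnW.
have [D HD] := tuple_bound PA M a.
have [b Hb] := strong_collection HF HI HR (add D (one N))
  (T := fun p w => sat E (env2 p w) g) (sat_upd2_arith HF HI HR _ _ _ _ HE).
exists b => e Hea /sat_fexs[e1 [He1 Hsat]].
(* [fcode M] reads the M + 1 variables 0, .., M. The last one carries no information and is set to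
   zero, so that all entries stay at most a. *)
pose ez i := if i < M then e i else zero N.
have ez_le i : le (ez i) a.
  by rewrite /ez; case: ltnP => [/Hea|_]; [apply: lt_le | apply: zero_le].
have [w1 Hw1] := finite_bound vs e1.
have pD : lt (eval ez (fcode M)) (add D (one N)).
  apply/(le_lt_succ PA); rewrite eval_fcode; apply: HD => [|i Hi].
    by rewrite size_map size_iota.
  rewrite -[ez 0 :: _]/[seq ez i | i <- iota 0 M.+1].
  by rewrite (nth_map 0) ?size_iota // nth_iota.
have [|w [wb /sat_fexs[e' [He']]]] := Hb _ pD.
  exists w1; apply/sat_fexs.
  pose e2 i := if i < M.+1 then ez i else env2 (eval ez (fcode M)) w1 i.
  have Ecode : eval e2 (fcode M) = eval ez (fcode M).
    rewrite !eval_fcode; congr tuple; apply/eq_in_map => i.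
    by rewrite mem_iota => /andP[_]; rewrite add1n /e2 => ->.
  have Ep : e2 M.+1 = eval ez (fcode M) by rewrite /e2 ltnn env2_p.
  have Ew : e2 M.+2 = w1 by rewrite /e2 ltnNge leqnSn /= env2_w.
  exists e2; split.
    by move=> i; rewrite mem_iota add0n leq0n /= /e2 => /negbTE ->.
  apply/sat_fand; split; first exact: etrans Ep (esym Ecode).
  apply/sat_fexbs => //; exists (fun i => if i < M then e1 i else e2 i); split.
  - move=> i ivs; case: ltnP => // iM.
    by rewrite He1 // /e2 /ez iM ltnS (ltnW iM).
  - by move=> i ivs; rewrite vsM // [eval _ _]Ew; apply: Hw1.
  - apply: iffLR Hsat; apply: sat_ext => // v /free_fbound vh.
    by rewrite (leq_trans vh hM).
move=> /sat_fand[Ecode /sat_fexbs[//|e2 [He2 Hw Hh]]].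
have {}Ecode : eval ez (fcode M) = eval e' (fcode M).
  by rewrite -[RHS]Ecode /= (off _ _ _ _ _ He') ?env2_p.
have Ee' i : i < M -> e' i = e i.
  by move=> iM; rewrite -(fcode_inj HF Ecode) ?ltnS ?(ltnW iM) // /ez iM.
exists (fun i => if i < M then e2 i else e i); split.
- by move=> i ivs; case: ltnP => // iM; rewrite He2 // Ee'.
- move=> i ivs; rewrite vsM //; apply: lt_trans wb => //.
  by have := Hw i ivs; rewrite /= (off _ _ _ _ _ He') ?env2_w.
- apply: iffLR Hh; apply: sat_ext => // v /free_fbound vh.
  by rewrite (leq_trans vh hM).
Qed.

(** By [block_bound], once z is large a satisfiable block has witnesses below z, so bounding it by z
    is harmless. The block variables then range up to z, hence the inner form must be correct below
    z and not just below a; this is why later thresholds depend on z. *)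
Lemma bounded_form_fexs m M vs h B g :
  {in vs, forall v, v < M} -> fbound h <= M -> M <= B ->
  bounded_form N m M h B.+1 g ->
  bounded_form N m.+1 M (fexs vs h) B (fexbs vs (tvar B) g).
Proof.
move=> vsM hM MB [Hg [gfree Hfar]]; split; first by rewrite delta0_fexbs.
split.
  move=> v /free_fexbs/orP[/eqP ->|/gfree]; first by rewrite addnS ltnS leq_addr.
  by rewrite addSnnS.
move=> E HE a; have [b Hb] := block_bound a vsM hM HE.
have [c [ac bc]] := ltl_max PA a b; exists c => z cz.
apply: far_mono (Hfar E HE z) => zs Ezs Hz e Hea.
have az := lt_trans PA ac cz; have bz := lt_trans PA bc cz.
have ovB i : i < M -> override B e (z :: zs) i = e i.
  by move=> iM; rewrite /override (leq_trans iM MB).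
have EB : eval (override B e (z :: zs)) (tvar B) = z.
  by rewrite /= /override ltnn subnn.
have Hocc : {in vs, forall v, ~~ occurs v (tvar B)}.
  by move=> v /vsM vM; rewrite /= neq_ltn (leq_trans vM MB).
have shift e' : agree_off vs (override B e (z :: zs)) e' ->
    forall i, override B.+1 e' zs i = e' i.
  move=> He' i; rewrite /override ltnS; case: leqP => // Bi.
  rewrite He'; last first.
    by apply/negP => /vsM iM; move: Bi; rewrite ltnNge ltnW ?(leq_trans iM).
  rewrite /override ltnNge (ltnW Bi) /= subnS.
  by case: (i - B) (subn_gt0 B i) => [|k] //=; rewrite Bi.
have Hz' e' : agree_off vs (override B e (z :: zs)) e' ->
    {in vs, forall i, lt (e' i) z} -> sat E e' g <-> sat E e' h.
  move=> He' Hl; rewrite -(Hz e') => [|i iM]; first by apply: sat_eq => i; rewrite shift.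
  case: (boolP (i \in vs)) => [/Hl //|ivs].
  by rewrite He' // ovB //; apply: lt_trans (Hea i iM) az.
split.
  move=> /sat_fexbs[//|e' [He' Hl Hs]]; rewrite EB in Hl.
  apply/sat_fexs; exists (fun i => if i < M then e' i else e i); split.
    by move=> i ivs; case: ltnP => // iM; rewrite He' // ovB.
  move/(Hz' _ He' Hl): Hs; apply: iffLR; apply: sat_ext => // v /free_fbound vh.
  by rewrite (leq_trans vh hM).
move=> /(Hb e Hea)[e' [He' Hl Hs]]; apply/sat_fexbs => //.
pose e2 i := if i < M then e' i else override B e (z :: zs) i.
have He2 : agree_off vs (override B e (z :: zs)) e2.
  by move=> i ivs; rewrite /e2; case: ltnP => // iM; rewrite He' // ovB.
have Hl2 : {in vs, forall i, lt (e2 i) z}.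
  by move=> i ivs; rewrite /e2 vsM //; apply: lt_trans (Hl i ivs) bz.
exists e2; rewrite EB; split=> //; apply/(Hz' e2) => //.
apply: iffLR Hs; apply: sat_ext => // v /free_fbound vh.
by rewrite /e2 (leq_trans vh hM).
Qed.

Lemma bounded_form_not m M h B g :
  bounded_form N m M h B g -> bounded_form N m M (fnot h) B (fnot g).
Proof.
move=> [Hg [gfree Hfar]]; split; first exact: Hg.
split; first exact: gfree.
move=> E HE a; apply: far_mono (Hfar E HE a) => s _ H e He.
by rewrite [sat _ _ (fnot _)]/= (H e He).
Qed.

Lemma bounded_form_ext m M h h' B g :
  (forall E (e : env), sat E e h <-> sat E e h') ->
  bounded_form N m M h B g -> bounded_form N m M h' B g.
Proof.
move=> Hh [Hg [gfree Hfar]]; do 2!split=> //.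
move=> E HE a; apply: far_mono (Hfar E HE a) => s _ H e He.
by rewrite (H e He).
Qed.

Lemma bounded_form_exists m M h B : Sigma m h \/ Pi m h -> fbound h <= M ->
  M <= B -> exists g, bounded_form N m M h B g.
Proof.
move=> Hh hM MB; elim: m h B Hh hM MB => [|m IHm] h B Hh hM MB.
  exists h; split; first by case: Hh => Hh; inversion Hh.
  split=> [v /free_fbound vh|E HE a e He].
    by rewrite addn0 (leq_trans vh) // (leq_trans hM).
  apply: sat_ext => // v /free_fbound vh.
  by rewrite /override (leq_trans vh) // (leq_trans hM).
have step vs h' : Sigma m h' \/ Pi m h' -> fbound (fexs vs h') <= M ->
    exists g, bounded_form N m.+1 M (fexs vs h') B g.
  move=> Hh' /fbound_fexs[vsM h'M].
  have [g Hg] := IHm h' B.+1 Hh' h'M (leqW MB).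
  by exists (fexbs vs (tvar B) g); apply: bounded_form_fexs.
case: Hh => [/Sigma_block|/Pi_block] [vs [h' [Eh Hh']]].
  by rewrite Eh; apply: step; [right | rewrite -Eh].
have /fbound_fexs[vsM h'M] : fbound (fexs vs h') <= M.
  move: hM; rewrite Eh; elim: (vs) => //= v us IHus.
  by rewrite !geq_max => /andP[-> /IHus].
have [g Hg] := IHm h' B.+1 (or_introl Hh') h'M (leqW MB).
(* A universal block is the negation of an existential block over [fnot h']. This formula need not
   be syntactically Sigma or Pi, so the existential step is applied to it through its bounded form
   alone. *)
have Hn := bounded_form_fexs (h := fnot h') vsM h'M MB (bounded_form_not Hg).
exists (fnot (fexbs vs (tvar B) (fnot g))); rewrite Eh.
apply: bounded_form_ext (bounded_form_not Hn) => E e.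
rewrite [sat _ _ (fnot _)]/= sat_fexs sat_falls; split=> [H e' He'|H [e' [He' Hs]]].
  by apply: NNPP => Hs; apply: H; exists e'.
by apply: Hs; apply: H.
Qed.

End Far.

(** * The coloring of tuples and its homogeneous sets *)

Section IncreasingSequences.
Variables (N : structure) (PA : P_minus N) (H : N -> Prop).

Lemma increasing_take k (s : seq N) : increasing H s -> increasing H (take k s).
Proof.
elim: s k => [|a s IHs] [|k] //= [Ha [Has Hs]]; split=> //.
by split; [case: s k Has {IHs Hs} => [|b s] [|k] | apply: IHs].
Qed.

Lemma increasing_cat a (s t : seq N) : increasing H (a :: s) ->
  increasing H (last a s :: t) -> increasing H (a :: s ++ t).
Proof.
elim: s a => [|b s IHs] a //= [Ha [ab Hs]] Ht.
by split=> //; split=> //; apply: IHs.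
Qed.

Lemma increasing_remove a b (s : seq N) : increasing H [:: a, b & s] ->
  increasing H (a :: s).
Proof.
case: s => [|c s] /= [Ha [ab [Hb [bc Hs]]]] //.
by split=> //; split=> //; apply: lt_trans bc.
Qed.

End IncreasingSequences.

Section Coloring.
Variables (N : structure) (HF : models_F N) (HI : induction_for N (Sigma 1)).
Variables (m : nat) (HR : realizes N (RT2 m.+3)).
Local Notation env := (nat -> N).
Let PA : P_minus N := F_P_minus HF.

Variables (M : nat) (vs : seq nat) (h g : formula) (I : N -> Prop) (e0 : env).
Local Notation EI := (fun _ : nat => I).

Definition arguments (x c : N) : env := upd (upd e0 0 x) 1 c.

Definition color_graph x c := sat EI (arguments x c) (fexs vs h).

Definition approx (e : env) (zs : seq N) := sat EI (override M e zs) g.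

Definition graph_approx x c z zs := exists e,
  [/\ agree_off vs (arguments x c) e, {in vs, forall i, lt (e i) z}
    & approx e zs].

(** For [zs] of length m + 1 the two sides use the first m and the last m entries. If m = 0 both
    windows are empty and the condition is trivial. *)
Definition stable a zs := forall e, (forall i, i < M -> lt (e i) a) ->
  (approx e (take m zs) <-> approx e (behead zs)).

Definition same_color a b z zs := exists c,
  [/\ lt c z, graph_approx a c z zs & graph_approx b c z zs].

Definition triple_color a b zs :=
  stable a zs /\ same_color a b (head (zero N) zs) (behead zs).

Hypothesis Hg : bounded_form N m M h M g.
Hypothesis HsI : sets I.
Hypothesis e0_bound : exists t, forall i, lt (e0 i) t.

Definition accurate a zs := forall e, (forall i, i < M -> lt (e i) a) ->
  (approx e zs <-> sat EI e h).

Lemma far_accurate a : far m (accurate a).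
Proof. by case: Hg => _ [_]; apply. Qed.

Lemma approx_ext e e' zs : (forall i, i < M -> e i = e' i) ->
  approx e zs <-> approx e' zs.
Proof.
move=> Ee; apply: sat_eq => i; rewrite /override.
by case: ifP => // /Ee.
Qed.

Lemma bounded_off x c z (e : env) : agree_off vs (arguments x c) e ->
  {in vs, forall i, lt (e i) z} -> (forall i, lt (e0 i) z) ->
  lt x z -> lt c z -> forall i, lt (e i) z.
Proof.
move=> He Hl e0z xz cz i; case: (boolP (i \in vs)) => [/Hl //|/He ->].
by rewrite /arguments /upd; case: eqP => // _; case: eqP.
Qed.

Lemma graph_approx_sound x c z zs : accurate z zs -> (forall i, lt (e0 i) z) ->
  lt x z -> lt c z -> graph_approx x c z zs -> color_graph x c.
Proof.
move=> Hacc e0z xz cz [e [He Hl Happ]]; apply/sat_fexs; exists e; split=> //.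
by apply/(Hacc e) => // i _; apply: bounded_off e0z xz cz i.
Qed.

(** It suffices that z exceed x, c, the parameters and the values of one true witness; accuracy of
    [zs] below z does the rest. *)
Lemma graph_approx_complete x c : color_graph x c ->
  exists t, forall z zs, lt t z -> accurate z zs -> graph_approx x c z zs.
Proof.
move=> /sat_fexs[e [He Hs]]; have [t0 e0t] := e0_bound.
have [t1 Ht1] := finite_bound HF vs e.
have [t2 [t12 xt2]] := ltl_max PA t1 x; have [t3 [t23 ct3]] := ltl_max PA t2 c.
have [t [t3t t0t]] := ltl_max PA t3 t0.
exists t => z zs tz Hacc.
have t3z := lt_trans PA t3t tz; have t2z := lt_trans PA t23 t3z.
have t1z := lt_trans PA t12 t2z; have t0z := lt_trans PA t0t tz.
have Hl : {in vs, forall i, lt (e i) z}.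
  by move=> i /Ht1 Hi; apply: lt_trans t1z.
exists e; split=> //; apply/Hacc => // i _.
apply: (bounded_off He Hl) => [j||]; last exact: lt_trans t3z.
- exact: (lt_trans PA (e0t j) t0z).
- exact: (lt_trans PA xt2 t2z).
Qed.

Lemma far_const n (P : Prop) : P -> far n (fun _ : seq N => P).
Proof. by move=> HP; elim: n => //= n IHn; exists (zero N). Qed.

Variables (X : N -> Prop) (k : N).
Hypothesis color_lt : forall x c, color_graph x c -> lt c k.
Hypothesis color_uniq : forall x c c',
  color_graph x c -> color_graph x c' -> c = c'.
Hypothesis color_ex : forall x, X x -> exists c, color_graph x c.

Variable H : N -> Prop.
Hypothesis HsH : sets H.
Hypothesis Hinf : infinite H.
Hypothesis HX : forall x, H x -> X x.

Lemma triple_color_far a b : H a -> H b -> exists zs,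
  [/\ size zs = m.+1, increasing H (b :: zs) &
      triple_color a b zs <-> exists c, color_graph a c /\ color_graph b c].
Proof.
move=> Ha Hb; have [ca Gaca] := color_ex (HX Ha).
have [cb Gbcb] := color_ex (HX Hb).
have [ta Hta] := graph_approx_complete Gaca.
have [tb Htb] := graph_approx_complete Gbcb.
have [te Hte] := e0_bound.
have [t1 [at1 bt1]] := ltl_max PA a b.
have [t2 [at2 bt2]] := ltl_max PA ta tb.
have [t3 [et3 ct3]] := ltl_max PA te ca.
have [t4 [t14 t24]] := ltl_max PA t1 t2.
have [t [t3t t4t]] := ltl_max PA t3 t4.
(* One tuple has to be far in two ways: its first m entries serve as bounds in [Q1], while in [Q2]
   its first entry is the bound z of color and witnesses and the others are the bounds. Accuracy of
   both windows below a yields stability. *)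
have Q1 : far m.+1 (fun zs => accurate a (take m zs)).
  exact/far_take/far_accurate.
have Q2 : far m.+1 (fun zs => [/\ accurate a (behead zs),
    lt t (head (zero N) zs) & accurate (head (zero N) zs) (behead zs)]).
  exists t => z tz /=; apply: far_mono (far_and HF (far_accurate a)
    (far_and HF (far_const m tz) (far_accurate z))) => s _.
  by move=> [? []].
have [zs [Ezs Hzs [Hacc1 [Hacc2 tz Hz]]]] :=
  far_increasing HF Hinf Hb (far_and HF Q1 Q2).
exists zs; split=> //.
have stab : stable a zs.
  by move=> e He; rewrite (Hacc1 e He) (Hacc2 e He).
set z := head _ _ in tz Hz *.
have t4z := lt_trans PA t4t tz; have t3z := lt_trans PA t3t tz.
have t1z := lt_trans PA t14 t4z; have t2z := lt_trans PA t24 t4z.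
have az := lt_trans PA at1 t1z; have bz := lt_trans PA bt1 t1z.
have e0z i : lt (e0 i) z.
  exact: (lt_trans PA (Hte i) (lt_trans PA et3 t3z)).
split=> [[_ [c [cz Gac Gbc]]]|[c [Gac Gbc]]].
  exists c; split.
    exact: graph_approx_sound Hz e0z az cz Gac.
  exact: graph_approx_sound Hz e0z bz cz Gbc.
split=> //; exists c; rewrite (color_uniq Gac Gaca); split.
- exact: (lt_trans PA ct3 t3z).
- exact: (Hta z _ (lt_trans PA at2 t2z) Hz).
rewrite -(color_uniq Gac Gaca) (color_uniq Gbc Gbcb).
exact: (Htb z _ (lt_trans PA bt2 t2z) Hz).
Qed.

Hypothesis Hhom : forall a b zs a' b' zs', size zs = m.+1 -> size zs' = m.+1 ->
  increasing H [:: a, b & zs] -> increasing H [:: a', b' & zs'] ->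
  (triple_color a b zs <-> triple_color a' b' zs').

Lemma common_color : exists c, forall x, H x -> color_graph x c.
Proof.
have Hlt : forall a b, H a -> H b -> lt a b ->
    exists c, color_graph a c /\ color_graph b c.
  apply: NNPP => Hno.
  (* If a single pair had a common color, a far tuple over it would have color 1, and homogeneity
     would give every pair a common color. *)
  have Hno' a b : H a -> H b -> lt a b ->
      ~ exists c, color_graph a c /\ color_graph b c.
    move=> Ha Hb ab Hc; apply: Hno => a' b' Ha' Hb' ab'.
    have [zs [Ezs Hzs Czs]] := triple_color_far Ha Hb.
    have [zs' [Ezs' Hzs' Czs']] := triple_color_far Ha' Hb'.
    apply/Czs'/(Hhom Ezs Ezs'); last exact/Czs.
      by split.
    by split.
  apply: (infinite_pigeonhole HF HI HR (k := k) (R := color_graph) HsH Hinf).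
  - exact: (sat_upd2_arith HF HI HR).
  - by move=> x /HX/color_ex[c Gxc]; exists c; split=> //; apply: color_lt Gxc.
  - move=> x y c Hx Hy _ Gx Gy.
    by case: (lt_total PA x y) => [xy|[//|yx]];
      [case: (Hno' x y) | case: (Hno' y x)] => //; exists c.
have [x0 [_ Hx0]] := Hinf (zero N); have [c Gx0] := color_ex (HX Hx0).
exists c => x Hx; case: (lt_total PA x x0) => [xx0|[-> //|x0x]].
  by have [c' [Gx /(color_uniq Gx0) ->]] := Hlt _ _ Hx Hx0 xx0.
by have [c' [/(color_uniq Gx0) -> Gx]] := Hlt _ _ Hx0 Hx x0x.
Qed.

(** By [common_color] a far tuple over a and b has color 1. Homogeneity passes this color to the
    given tuple, far or not, and color 1 includes stability. *)
Lemma homogeneous_stable a b zs : size zs = m.+1 ->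
  increasing H [:: a, b & zs] -> stable a zs.
Proof.
move=> Ezs Hzs.
have [Ha [ab [Hb _]]] := Hzs.
have [zs' [Ezs' Hzs' Czs']] := triple_color_far Ha Hb.
have [c Gc] := common_color.
suff [] : triple_color a b zs by [].
have Habzs' : increasing H [:: a, b & zs'] by split.
by apply/(Hhom Ezs Ezs' Hzs Habzs')/Czs'; exists c; split; apply: Gc.
Qed.

(** Append a far s and slide the window of m bounds from [zs] to s. Every single step preserves the
    truth value by stability, and at s the bounded form is accurate. *)
Lemma homogeneous_accurate a b zs : size zs = m ->
  increasing H [:: a, b & zs] -> accurate a zs.
Proof.
move=> Ezs Hzs.
(* The entry leaving the window takes over the second place of the tuple, on which stability does
   not depend; therefore b is generalized. *)
have shift j : forall b s, size s = m + j -> increasing H [:: a, b & s] ->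
    forall e, (forall i, i < M -> lt (e i) a) ->
    approx e (take m s) <-> approx e (drop j s).
  elim: j => [|j IHj] b' s Es Hs e He.
    by rewrite drop0 take_oversize // Es addn0.
  case: s Es Hs => [|y s]; first by rewrite addnS.
  rewrite addnS => -[Es] Hs.
  have Etake : size (take m.+1 (y :: s)) = m.+1.
    by rewrite size_takel //= ltnS Es leq_addr.
  have := homogeneous_stable Etake (increasing_take m.+3 Hs) He.
  rewrite take_takel // => ->; exact: IHj Es (increasing_remove PA Hs) e He.
have Hlast : H (last b zs).
  case: Hzs => _ [_ Hbz]; elim: (zs) (b) Hbz => [|y s IHs] b' /= [Hb' [_ Hs]] //.
  exact: IHs.
have [s [Es Hs Hacc]] := far_increasing HF Hinf Hlast (far_accurate a).
have Hcat : increasing H [:: a, b & zs ++ s].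
  exact: (increasing_cat (s := b :: zs)).
move=> e He; rewrite -(Hacc e He).
have := shift m b (zs ++ s) _ Hcat e He.
by rewrite take_size_cat // drop_size_cat //; apply; rewrite size_cat Ezs Es.
Qed.

Lemma color_from_homogeneous x c : H x ->
  color_graph x c <-> exists a b zs,
    [/\ size zs = m, increasing H [:: a, b & zs], lt x a, lt c a
      & (forall i, lt (e0 i) a) /\ graph_approx x c a zs].
Proof.
move=> Hx; split=> [Gxc|[a [b [zs [Ezs Hzs xa ca [e0a Gxc]]]]]]; last first.
  exact: graph_approx_sound (homogeneous_accurate Ezs Hzs) e0a xa ca Gxc.
have [t Ht] := graph_approx_complete Gxc; have [te Hte] := e0_bound.
have [t1 [xt1 ct1]] := ltl_max PA x c; have [t2 [tt2 et2]] := ltl_max PA t te.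
have [t3 [t13 t23]] := ltl_max PA t1 t2; have [a [t3a Ha]] := Hinf t3.
have t1a := lt_trans PA t13 t3a; have t2a := lt_trans PA t23 t3a.
have [s [Es Hs]] := increasing_extend m.+1 Hinf Ha.
case: s Es Hs => [//|b zs] [Ezs] Hzs.
exists a, b, zs; split=> //.
- exact: (lt_trans PA xt1 t1a).
- exact: (lt_trans PA ct1 t1a).
split; first by move=> i; apply: (lt_trans PA (Hte i) (lt_trans PA et2 t2a)).
exact: (Ht _ _ (lt_trans PA tt2 t2a) (homogeneous_accurate Ezs Hzs)).
Qed.

End Coloring.

(** * The functionals *)

Local Notation columns := parameters_from_columns.

Lemma delta0_columns f : delta0 (columns f) = delta0 f.
Proof. by elim: f => //= [f -> g ->|f -> g ->|f -> g ->]. Qed.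

Fixpoint Sigma_columns m f (Hf : Sigma m f) : Sigma m (columns f) :=
  match Hf with
  | Sigma_delta0 f Hf => Sigma_delta0 (eq_ind_r is_true Hf (delta0_columns f))
  | Sigma_Pi m f Hf => Sigma_Pi (Pi_columns Hf)
  | Sigma_ex m v f Hf => Sigma_ex v (Sigma_columns Hf)
  end
with Pi_columns m f (Hf : Pi m f) : Pi m (columns f) :=
  match Hf with
  | Pi_delta0 f Hf => Pi_delta0 (eq_ind_r is_true Hf (delta0_columns f))
  | Pi_Sigma m f Hf => Pi_Sigma (Sigma_columns Hf)
  | Pi_all m v f Hf => Pi_all v (Pi_columns Hf)
  end.

Lemma free_columns v f : free v (columns f) = free v f.
Proof.
have occurs_num j : occurs v (tnum j) = false by elim: j.
elim: f => //= [t j|f -> g ->|f -> g ->|f -> g ->|w f ->|w f ->|w t f ->|w t f ->] //.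
by rewrite occurs_num /= orbb orbF.
Qed.

(** [is_instance] evaluates the instance formula with no solution set, [holds] with one; formulas
    that mention only [vI] cannot tell the difference. *)
Fixpoint only_vI (f : formula) : bool :=
  match f with
  | feq _ _ | flt _ _ => true
  | fmem _ j => j == 0
  | fnot f => only_vI f
  | fand f g | for_ f g | fimp f g => only_vI f && only_vI g
  | fall _ f | fex _ f | fallb _ _ f | fexb _ _ f => only_vI f
  end.

Lemma only_vI_columns f : only_vI (columns f).
Proof. by elim: f => //= [f -> g ->|f -> g ->|f -> g ->]. Qed.

Lemma only_vI_fexs vs f : only_vI (fexs vs f) = only_vI f.
Proof. by elim: vs. Qed.

Lemma only_vI_fconj (s : seq nat) (F : nat -> formula) :
  (forall i, only_vI (F i)) -> only_vI (fconj [seq F i | i <- s]).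
Proof. by move=> HF; elim: s => //= i s ->; rewrite HF. Qed.

Lemma sat_only_vI (N : structure) E E' (e : nat -> N) f : only_vI f ->
  (forall x, E 0 x <-> E' 0 x) -> sat E e f <-> sat E' e f.
Proof.
move=> Hf HE; elim: f e Hf => /=;
  do ?[by move=> f IHf g IHg e /andP[/(IHf e) {}IHf /(IHg e) {}IHg]; tauto].
- by [].
- by [].
- by move=> t j e /eqP ->; apply: HE.
- by move=> f IHf e /(IHf e) {}IHf; tauto.
- by move=> v f IHf e Hf; apply: all_iff => a; apply: IHf.
- by move=> v f IHf e Hf; apply: ex_iff => a; apply: IHf.
- by move=> v t f IHf e Hf; apply: all_iff => a; apply: imp_iff => //; apply: IHf.
- by move=> v t f IHf e Hf; apply: ex_iff => a; apply: and_iff => //; apply: IHf.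
Qed.

Lemma only_vI_php_instance r f : only_vI (php_instance r f).
Proof.
have Hg : only_vI (fgraph r f).
  by rewrite /fgraph only_vI_fexs /= only_vI_fconj //= only_vI_columns.
by rewrite /= !Hg only_vI_fconj.
Qed.

Lemma finite_choice (T : Type) (t0 : T) (P : nat -> T -> Prop) r :
  (forall j, j < r -> exists t, P j t) ->
  exists F, forall j, j < r -> P j (F j).
Proof.
elim: r => [|r IHr] HP; first by exists (fun _ => t0).
have [|F HF] := IHr; first by move=> j jr; apply: HP; apply: leqW.
have [t Ht] := HP r (ltnSn r); exists (upd F r t) => j.
rewrite ltnS leq_eqVlt => /orP[/eqP ->|jr]; first by rewrite upd_eq.
by rewrite upd_neq ?neq_ltn ?jr //; apply: HF.
Qed.

Section Formulas.
Variables (r M m : nat) (vs : seq nat) (g : formula).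

(** Variables below M other than the two arguments and the parameters become zero, in accordance
    with [base_env]; the variables from M on receive the bounds. *)
Definition subst_args (u q : nat) (L : seq term) (i : nat) : term :=
  if i == 0 then tvar u else if i == 1 then tvar q else
  if i < r.+2 then tvar i else if i < M then tzero else nth tzero L (i - M).

Definition fparameters : formula :=
  fconj [seq fcol 2 (tpair (tnum j) (tvar j.+2)) | j <- iota 0 r].

Definition fapprox (L : seq term) : formula :=
  fsub (fun i => if i < M then tvar i else nth tzero L (i - M)) (fun _ => 0) g.

(** The bound t of the outer block is placed in variable M + m, the first one beyond the free
    variables of g. *)
Definition fgraph_approx (u q : nat) (t : term) (L : seq term) : formula :=
  fsub (subst_args u q (rcons L t)) (fun _ => 0) (fexbs vs (tvar (M + m)) g).

Definition tvars (v n : nat) : seq term := [seq tvar i | i <- iota v n].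

(** Variables M, .., M + m + 2 hold a_0, .., a_n. The stability clause may rebind all variables
    below M, parameters included, because it speaks of arbitrary assignments; in the second clause
    variable 1 is the common color. *)
Definition ftriple_color : formula :=
  fand (fallbs (iota 0 M) (tvar M)
          (fiff (fapprox (tvars M.+2 m)) (fapprox (tvars M.+3 m))))
       (fexb 1 (tvar M.+2)
          (fand (fgraph_approx M 1 (tvar M.+2) (tvars M.+3 m))
                (fgraph_approx M.+1 1 (tvar M.+2) (tvars M.+3 m)))).

Definition fcoloring : formula :=
  for_ (fexb M (tadd (tvar 0) tone)
         (fand (feq (tvar 0) (tpair (tnum 0) (tvar M))) (fcol 0 (tvar M))))
       (fexbs (iota M m.+3) (tadd (tvar 0) tone)
         (fand (feq (tvar 0) (tpair (tnum 1) (ttuple (tvar M) (tvars M.+1 m.+2))))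
               ftriple_color)).

(** The numbers p_j have no bound in terms of the input and are fetched by an unbounded block. They
    are unique, so the existential and the universal form agree. *)
Definition coloring_sigma : formula :=
  fexs (iota 2 r) (fand fparameters fcoloring).
Definition coloring_pi : formula :=
  falls (iota 2 r) (fimp fparameters fcoloring).

Definition findex (q : nat) : formula :=
  fand fparameters (fand (fmem (tvar 1) vS) (fand (fincreasing_in_S M m.+2)
  (fand (flt (tvar 1) (tvar M)) (fand (flt (tvar q) (tvar M))
  (fand (fconj [seq flt (tvar j.+2) (tvar M) | j <- iota 0 r])
    (fgraph_approx 1 q (tvar M) (tvars M.+2 m))))))).

Definition index_vars : seq nat := 1 :: iota 2 r ++ iota M m.+2.

Definition index_sigma : formula := fexs index_vars (findex 0).
(** Every color found by the search, held in the fresh variable M + m + 2, equals the input. This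
    agrees with the existential form because exactly one color is found. *)
Definition index_pi : formula :=
  fall (M + m.+2) (falls index_vars
    (fimp (findex (M + m.+2)) (feq (tvar 0) (tvar (M + m.+2))))).

Hypothesis Hg : delta0 g.

Lemma delta0_fcoloring : delta0 fcoloring.
Proof.
by rewrite /= !delta0_fexbs /= delta0_fallbs /= !delta0_fsub !delta0_fexbs Hg.
Qed.

Lemma delta0_fparameters : delta0 fparameters.
Proof. exact: delta0_fconj. Qed.

Lemma delta0_findex q : delta0 (findex q).
Proof.
by rewrite /= delta0_fparameters !delta0_fconj //= !delta0_fsub !delta0_fexbs Hg.
Qed.

Lemma coloring_sigmaP : Sigma 1 coloring_sigma.
Proof.
apply/fexs_Sigma/delta0_Sigma1/andP.
by split; [apply: delta0_fparameters | apply: delta0_fcoloring].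
Qed.

Lemma coloring_piP : Pi 1 coloring_pi.
Proof.
apply/falls_Pi/delta0_Pi1/andP.
by split; [apply: delta0_fparameters | apply: delta0_fcoloring].
Qed.

Lemma index_sigmaP : Sigma 1 index_sigma.
Proof. exact/fexs_Sigma/delta0_Sigma1/delta0_findex. Qed.

Lemma index_piP : Pi 1 index_pi.
Proof.
apply/Pi_all/falls_Pi/delta0_Pi1/andP; split=> //.
exact: delta0_findex.
Qed.

Definition coloring_functional := Functional coloring_sigmaP coloring_piP.
Definition index_functional := Functional index_sigmaP index_piP.

End Formulas.

(** In the strong reduction the homogeneous set is itself the solution; being the only oracle there,
    it is set variable 0. *)
Definition copy_functional : functional :=
  @Functional (fmem (tvar 0) 0) (fmem (tvar 0) 0)
    (@delta0_Sigma1 (fmem _ _) isT) (@delta0_Pi1 (fmem _ _) isT).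

(** * Meaning of the formulas that define the functionals *)

Section FormulaSemantics.
Variables (N : structure) (PA : P_minus N).
Local Notation env := (nat -> N).
Variables (r M m : nat) (vs : seq nat) (g : formula) (I : N -> Prop).
Variable p : env.
Hypothesis rM : r.+2 <= M.
Hypothesis vsM : {in vs, forall v, v < M}.
Hypothesis gM : forall v, free v g -> v < M + m.
Hypothesis Hp : forall j, j < r ->
  forall q, I (pair (num N 2) (pair (num N j) q)) <-> q = p j.
Local Notation approxI := (approx M g I).

Definition base_env : env :=
  fun i => if 1 < i < r.+2 then p (i - 2) else zero N.

Local Notation graph_approx := (graph_approx M vs g I base_env).
Local Notation triple_color := (triple_color m M vs g I base_env).
Local Notation sets_I E := (E 0 = I).

Definition has_parameters (e : env) := forall j, j < r -> e j.+2 = p j.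

Lemma sat_fcol E (e : env) i t :
  sat E e (fcol i t) <-> E 0 (pair (num N i) (eval e t)).
Proof. by rewrite -(eval_tnum e). Qed.

Lemma sat_fparameters E e : sets_I E ->
  sat E e (fparameters r) <-> has_parameters e.
Proof.
move=> EI; rewrite sat_fconj; split=> [H j jr|H j].
  have /H : j \in iota 0 r by rewrite mem_iota.
  move=> Hj; apply/(Hp jr).
  by have := iffLR (sat_fcol _ _ _ _) Hj; rewrite eval_tpair eval_tnum EI.
rewrite mem_iota add0n => /= jr.
apply: (iffRL (sat_fcol E e 2 (tpair (tnum j) (tvar j.+2)))).
by rewrite eval_tpair eval_tnum EI; apply/(Hp jr)/H.
Qed.

Lemma map_eval_nth (e : env) L i :
  eval e (nth tzero L i) = nth (zero N) [seq eval e t | t <- L] i.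
Proof.
case: (ltnP i (size L)) => Hi; first by rewrite (nth_map tzero).
by rewrite !nth_default ?size_map.
Qed.

Lemma map_eval_tvars (e : env) v n :
  [seq eval e t | t <- tvars v n] = [seq e i | i <- iota v n].
Proof. by rewrite -map_comp. Qed.

Lemma sat_fapprox E e L : sets_I E ->
  sat E e (fapprox M g L) <-> approxI e [seq eval e t | t <- L].
Proof.
move=> EI; rewrite sat_fsub /approx EI; apply: sat_eq => i.
by rewrite /override; case: ifP => // _; apply: map_eval_nth.
Qed.

Lemma sat_fgraph_approx E e u q t L : sets_I E -> has_parameters e ->
  size L = m ->
  sat E e (fgraph_approx r M m vs g u q t L) <->
  graph_approx (e u) (e q) (eval e t) [seq eval e t | t <- L].
Proof.
move=> EI He EL; rewrite sat_fsub EI.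
set e1 := fun i => eval e _.
have e1_lt i : i < M -> e1 i = arguments base_env (e u) (e q) i.
  rewrite /e1 /subst_args /arguments /upd /base_env.
  case: i => [|[|i]] //= iM; rewrite !ltnS.
  by case: ltnP => [ir|_]; rewrite ?iM /= ?subn2 ?He.
have e1_ge i : M <= i ->
    e1 i = nth (zero N) (rcons [seq eval e t | t <- L] (eval e t)) (i - M).
  move=> Mi; rewrite /e1 /subst_args.
  have ri := leq_trans rM Mi.
  rewrite !gtn_eqF ?(leq_trans _ ri) // !ifN -?leqNgt //.
  by rewrite map_eval_nth map_rcons.
have Et : eval e1 (tvar (M + m)) = eval e t.
  by rewrite /= e1_ge ?leq_addr // addKn nth_rcons size_map EL ltnn eqxx.
have Hocc : {in vs, forall v, ~~ occurs v (tvar (M + m))}.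
  by move=> v /vsM vM; rewrite /= neq_ltn (leq_trans vM) // leq_addr.
rewrite sat_fexbs // Et.
split=> -[e' [He' Hl Hs]].
  exists (fun i => if i < M then e' i else arguments base_env (e u) (e q) i).
  split.
  - by move=> i ivs; case: ltnP => // iM; rewrite He' // e1_lt.
  - by move=> i ivs; rewrite vsM //; apply: Hl.
  apply: iffLR Hs; apply: sat_ext => // i /gM iMm.
  rewrite /override; case: ltnP => // Mi.
  rewrite He' ?e1_ge //; last by apply/negP => /vsM; rewrite ltnNge Mi.
  by rewrite nth_rcons size_map EL ltn_subLR // iMm.
exists (fun i => if i < M then e' i else e1 i); split.
- by move=> i ivs; case: ltnP => // iM; rewrite He' // e1_lt.
- by move=> i ivs; rewrite vsM //; apply: Hl.
apply: iffLR Hs; apply: sat_ext => // i /gM iMm.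
rewrite /override; case: ltnP => // Mi.
by rewrite e1_ge // nth_rcons size_map EL ltn_subLR // iMm.
Qed.

Lemma sat_ftriple_color E e : sets_I E -> has_parameters e ->
  sat E e (ftriple_color r M m vs g) <->
  triple_color (e M) (e M.+1) [seq e i | i <- iota M.+2 m.+1].
Proof.
move=> EI He; rewrite sat_fand; apply: and_iff.
  have Hocc : {in iota 0 M, forall v, ~~ occurs v (tvar M)}.
    by move=> v; rewrite mem_iota add0n => /= vM; rewrite neq_ltn vM.
  rewrite sat_fallbs //.
  have Hseq e' : agree_off (iota 0 M) e e' -> forall v n, M <= v ->
      [seq eval e' t | t <- tvars v n] = [seq e i | i <- iota v n].
    move=> He' v n Mv; rewrite map_eval_tvars; apply/eq_in_map => i.
    rewrite mem_iota => /andP[vi _]; apply: He'.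
    by rewrite mem_iota add0n -leqNgt (leq_trans Mv vi).
  have Etake : take m [seq e i | i <- iota M.+2 m.+1] =
      [seq e i | i <- iota M.+2 m].
    by rewrite -map_take take_iota (minn_idPl (leqnSn m)).
  split=> [H e1 He1|H e1 He1 Hl].
    pose e2 i := if i < M then e1 i else e i.
    have He2 : agree_off (iota 0 M) e e2.
      by move=> i; rewrite mem_iota add0n /e2 => /= /negbTE ->.
    have Hl2 : {in iota 0 M, forall i, lt (e2 i) (eval e (tvar M))}.
      by move=> i; rewrite mem_iota add0n /e2 => /= iM; rewrite iM; apply: He1.
    have := H _ He2 Hl2; rewrite sat_fiff !sat_fapprox // !(Hseq _ He2) ?leqW //.
    have Happ zs : approxI e2 zs <-> approxI e1 zs.
      by apply: approx_ext => i iM; rewrite /e2 iM.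
    by rewrite !Happ Etake.
  rewrite sat_fiff !sat_fapprox // !(Hseq _ He1) ?leqW //.
  have := H e1; rewrite Etake; apply=> i iM; apply: Hl.
  by rewrite mem_iota.
have M_gt1 : 1 < M by apply: leq_trans rM.
have M1 : (M.+1 == 1) = false by apply/gtn_eqF/leqW.
have M0 : (M == 1) = false by apply/gtn_eqF.
apply: ex_iff => c.
have Hc : has_parameters (upd e 1 c).
  by move=> j jr; rewrite upd_neq // He.
have Hseq : [seq eval (upd e 1 c) t | t <- tvars M.+3 m] =
    [seq e i | i <- iota M.+3 m].
  rewrite map_eval_tvars; apply/eq_in_map => i.
  by rewrite mem_iota => /andP[Mi _]; rewrite upd_neq // gtn_eqF // (leq_trans _ Mi).
have Hu : eval (upd e 1 c) (tvar M.+2) = e M.+2 by rewrite /= upd_neq.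
have S1 := sat_fgraph_approx M 1 (tvar M.+2) EI Hc (L := tvars M.+3 m).
have S2 := sat_fgraph_approx M.+1 1 (tvar M.+2) EI Hc (L := tvars M.+3 m).
rewrite Hseq Hu upd_eq !upd_neq ?M0 ?M1 // in S1 S2.
have sz : size (tvars M.+3 m) = m by rewrite size_map size_iota.
split=> [[c_lt [/(S1 sz) ? /(S2 sz) ?]]|[c_lt /(S1 sz) ? /(S2 sz) ?]] //.
Qed.

Definition coloring_set (x : N) : Prop :=
  (exists i, x = pair (num N 0) i /\ I (pair (num N 0) i)) \/
  exists a b zs, [/\ size zs = m.+1,
    x = pair (num N 1) (tuple a (b :: zs)) & triple_color a b zs].

Lemma sat_fcoloring E e : sets_I E -> has_parameters e ->
  sat E e (fcoloring r M m vs g) <-> coloring_set (e 0).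
Proof.
move=> EI He.
have M_gt0 : 0 < M by apply: leq_trans rM.
have M_neq0 : 0 != M by rewrite neq_ltn M_gt0.
rewrite sat_for; apply: or_iff.
  have Etm i : eval (upd e M i) (tpair (tnum 0) (tvar M)) = pair (num N 0) i.
    by rewrite eval_tpair eval_tnum /= upd_eq.
  have E0 i : upd e M i 0 = e 0 by rewrite upd_neq.
  split=> [[i [_ [Ex Hi]]]|[i [Ex Hi]]]; exists i.
    by split; [rewrite -(E0 i) [LHS]Ex Etm | rewrite -Etm -EI].
  split; first by rewrite /= Ex; apply/(le_lt_succ PA)/(le_pair_r PA).
  split; first exact: etrans (E0 i) (etrans Ex (esym (Etm i))).
  by move: Hi; rewrite -(Etm i) -EI.
have Hocc : {in iota M m.+3, forall v, ~~ occurs v (tadd (tvar 0) tone)}.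
  move=> v; rewrite mem_iota => /andP[Mv _]; apply: occurs_succ_var.
  by rewrite neq_ltn (leq_trans M_gt0 Mv) orbT.
have off0 e' : agree_off (iota M m.+3) e e' ->
    e' 0 = e 0 /\ has_parameters e'.
  move=> He'; split=> [|j jr]; first by apply: He'; rewrite mem_iota leqNgt M_gt0.
  by rewrite -He //; apply: He'; rewrite mem_iota leqNgt (leq_trans _ rM).
have Etm e' : eval e' (tpair (tnum 1) (ttuple (tvar M) (tvars M.+1 m.+2))) =
    pair (num N 1) (tuple (e' M) [seq e' i | i <- iota M.+1 m.+2]).
  by rewrite eval_tpair eval_tnum eval_ttuple map_eval_tvars.
rewrite sat_fexbs //; split.
  move=> [e' [He' _ [Ex Hcol]]]; have [E0 Hpar] := off0 _ He'.
  exists (e' M), (e' M.+1), [seq e' i | i <- iota M.+2 m.+1]; split.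
  - by rewrite size_map size_iota.
  - by rewrite -E0 [LHS]Ex Etm.
  - exact: iffLR (sat_ftriple_color EI Hpar) Hcol.
move=> [a [b [zs [Ezs Ex Hcol]]]]; set s := [:: a, b & zs] in Ex *.
have Es : size s = m.+3 by rewrite /= Ezs.
pose e' i := if i \in iota M m.+3 then nth (zero N) s (i - M) else e i.
have He' : agree_off (iota M m.+3) e e' by move=> i /negbTE Hi; rewrite /e' Hi.
have [E0 Hpar] := off0 _ He'.
have Ee' i : i < m.+3 -> e' (M + i) = nth (zero N) s i.
  by move=> im; rewrite /e' mem_iota leq_addr ltn_add2l im addKn.
have Es' : [seq e' i | i <- iota M m.+3] = s.
  apply: (@eq_from_nth _ (zero N)); rewrite size_map size_iota ?Es // => i im.
  by rewrite (nth_map 0) ?size_iota // nth_iota // Ee'.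
have [Ea Eb Ezs'] : [/\ e' M = a, e' M.+1 = b &
    [seq e' i | i <- iota M.+2 m.+1] = zs].
  by split; [case: Es' | case: Es' | case: Es'].
exists e'; split=> //.
  move=> i; rewrite mem_iota => /andP[Mi im]; rewrite -(subnKC Mi) Ee'.
    apply/(le_lt_succ PA); rewrite /= Ex; apply: (le_trans PA _ (le_pair_r PA _ _)).
    apply: (@le_tuple_nth _ PA a (b :: zs)).
    by rewrite /= Ezs ltn_subLR.
  by rewrite ltn_subLR.
have Ex' : e 0 = eval e' (tpair (tnum 1) (ttuple (tvar M) (tvars M.+1 m.+2))).
  by rewrite Etm Ex Ea -Ezs' -Eb.
apply/sat_fand; split; first exact: etrans E0 Ex'.
by apply/(sat_ftriple_color EI Hpar); rewrite Ea Eb Ezs'.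
Qed.

Lemma sat_coloring E e : sets_I E ->
  (sat E e (coloring_sigma r M m vs g) <-> coloring_set (e 0)) /\
  (sat E e (coloring_pi r M m vs g) <-> coloring_set (e 0)).
Proof.
move=> EI; rewrite sat_fexs sat_falls.
have off0 e' : agree_off (iota 2 r) e e' -> e' 0 = e 0 by apply; rewrite mem_iota.
pose e1 i := if i \in iota 2 r then p (i - 2) else e i.
have He1 : agree_off (iota 2 r) e e1 by move=> i /negbTE Hi; rewrite /e1 Hi.
have Hpar : has_parameters e1.
  by move=> j jr; rewrite /e1 mem_iota /= add2n !ltnS jr subn2.
have Hcol e' : agree_off (iota 2 r) e e' -> sat E e' (fparameters r) ->
    sat E e' (fcoloring r M m vs g) <-> coloring_set (e 0).
  by move=> /off0 <- /sat_fparameters Hp'; apply: sat_fcoloring => //; apply: Hp'.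
have Hp1 : sat E e1 (fparameters r) by apply/sat_fparameters.
split; split.
- by move=> [e' [He' [Hp' /Hcol]]]; apply.
- by move=> Hc; exists e1; do 2!split=> //; apply/Hcol.
- by move=> /(_ e1 He1 Hp1)/Hcol; apply.
- by move=> Hc e' He' Hp'; apply/Hcol.
Qed.

Definition index_set (S : N -> Prop) (c : N) : Prop := exists x, S x /\
  exists a b zs, [/\ size zs = m, increasing S [:: a, b & zs], lt x a, lt c a
    & (forall i, lt (base_env i) a) /\ graph_approx x c a zs].

Lemma sat_findex E e q : sets_I E -> sat E e (findex r M m vs g q) <->
  has_parameters e /\ E 1 (e 1) /\
  increasing (E 1) [seq e i | i <- iota M m.+2] /\ lt (e 1) (e M) /\
  lt (e q) (e M) /\ (forall i, lt (base_env i) (e M)) /\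
  graph_approx (e 1) (e q) (e M) [seq e i | i <- iota M.+2 m].
Proof.
move=> EI; have -> : sat E e (findex r M m vs g q) <->
    sat E e (fparameters r) /\ E 1 (e 1) /\
    sat E e (fincreasing_in_S M m.+2) /\ lt (e 1) (e M) /\ lt (e q) (e M) /\
    sat E e (fconj [seq flt (tvar j.+2) (tvar M) | j <- iota 0 r]) /\
    sat E e (fgraph_approx r M m vs g 1 q (tvar M) (tvars M.+2 m)) by [].
rewrite sat_fparameters // sat_fincreasing sat_fconj.
have bound : has_parameters e -> lt (e 1) (e M) ->
    {in iota 0 r, forall j, sat E e (flt (tvar j.+2) (tvar M))} <->
    (forall i, lt (base_env i) (e M)).
  move=> He xM; split=> H i.
    rewrite /base_env; case: ifP => [/andP[i1 ir]|_]; last first.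
      exact: le_lt_trans PA _ _ _ (zero_le PA _) xM.
    case: i i1 ir => [|[|i]] // _; rewrite !ltnS => ir.
    by rewrite subn2 /= -He //; apply: H; rewrite mem_iota.
  rewrite mem_iota add0n => /= ir; have := H i.+2.
  by rewrite /base_env !ltnS ir subn2 /= -He.
split=> [[He [Hx [Hinc [xM [cM [Hb Hg]]]]]]|[He [Hx [Hinc [xM [cM [Hb Hg]]]]]]].
  do ![split=> //]; first exact/(bound He xM).
  have := iffLR (sat_fgraph_approx _ _ _ EI He _) Hg.
  by rewrite size_map size_iota map_eval_tvars; apply.
do ![split=> //]; first exact/(bound He xM).
apply/sat_fgraph_approx => //; first by rewrite size_map size_iota.
by rewrite map_eval_tvars.
Qed.

Lemma mem_index_vars i : (i \in index_vars r M m) =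
  [|| i == 1, 1 < i < r.+2 | M <= i < M + m.+2].
Proof. by rewrite inE mem_cat !mem_iota add2n. Qed.

Lemma index_setP E e q : sets_I E -> q \notin index_vars r M m ->
  index_set (E 1) (e q) <->
  exists e', agree_off (index_vars r M m) e e' /\ sat E e' (findex r M m vs g q).
Proof.
move=> EI qV.
have M_gt1 : 1 < M by apply: leq_trans rM.
split=> [[x [Sx [a [b [zs [Ezs Hs xa ca [e0a Happ]]]]]]]|[e' [He' /sat_findex H]]].
  set s := [:: a, b & zs] in Hs.
  have Es : size s = m.+2 by rewrite /= Ezs.
  pose e' i := if i \in index_vars r M m then
    (if i == 1 then x else if i < M then p (i - 2) else nth (zero N) s (i - M))
    else e i.
  have Ee' i : i < m.+2 -> e' (M + i) = nth (zero N) s i.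
    move=> im; rewrite /e' mem_index_vars leq_addr ltn_add2l im !orbT.
    by rewrite gtn_eqF ?ltn_addr // ltnNge leq_addr addKn.
  have Es' : [seq e' i | i <- iota M m.+2] = s.
    apply: (@eq_from_nth _ (zero N)); rewrite size_map size_iota ?Es // => i im.
    by rewrite (nth_map 0) ?size_iota // nth_iota // Ee'.
  have [Ea Ezs'] : e' M = a /\ [seq e' i | i <- iota M.+2 m] = zs.
    by split; case: Es'.
  have E1 : e' 1 = x by rewrite /e' mem_index_vars.
  have Eq : e' q = e q by rewrite /e' (negbTE qV).
  exists e'; split; first by move=> i /negbTE Hi; rewrite /e' Hi.
  apply/sat_findex => //; rewrite Es' Ezs' Ea E1 Eq; do ![split=> //].
  move=> j jr; rewrite /e' mem_index_vars /= !ltnS jr /= subn2.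
  by rewrite (leq_trans _ rM).
move: H => /(_ EI)[Hpar [Hx [Hinc [xM [cM [Hb Happ]]]]]].
rewrite -(He' _ qV); exists (e' 1); split=> //.
exists (e' M), (e' M.+1), [seq e' i | i <- iota M.+2 m]; split=> //.
by rewrite size_map size_iota.
Qed.

Lemma sat_index E e : sets_I E ->
  (sat E e (index_sigma r M m vs g) <-> index_set (E 1) (e 0)) /\
  (sat E e (index_pi r M m vs g) <-> forall c, index_set (E 1) c -> e 0 = c).
Proof.
move=> EI; have M_gt0 : 0 < M by apply: leq_trans rM.
have V0 : 0 \notin index_vars r M m.
  by rewrite mem_index_vars /= leqNgt M_gt0.
set C := M + m.+2.
have VC : C \notin index_vars r M m.
  rewrite mem_index_vars ltnn andbF orbF negb_or /C gtn_eqF /=; last first.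
    by apply: leq_trans (leq_addr _ _); apply: leq_trans rM.
  by rewrite negb_and -!leqNgt (leq_trans rM) ?orbT // leq_addr.
have C0 : 0 != C by rewrite neq_ltn ltn_addr.
split; first by rewrite sat_fexs index_setP.
have off c e' : agree_off (index_vars r M m) (upd e C c) e' ->
    e' 0 = e 0 /\ e' C = c.
  by move=> He'; rewrite !He' // upd_eq upd_neq.
have -> : sat E e (index_pi r M m vs g) <-> forall c, sat E (upd e C c)
    (falls (index_vars r M m) (fimp (findex r M m vs g C) (feq (tvar 0) (tvar C)))).
  by [].
split=> [H c|H c].
  rewrite -{1}(upd_eq e C c) => /(index_setP _ EI VC)[e' [He' Hs]].
  have [E0 Ec] := off _ _ He'.
  have Himp := iffLR (sat_falls _ _ _ _) (H c) e' He'.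
  by rewrite -E0 -Ec; apply: Himp Hs.
apply/sat_falls => e' He'; apply/sat_fimp => Hs.
have [E0 Ec] := off _ _ He'.
have HC : index_set (E 1) (upd e C c C) by apply/index_setP => //; exists e'.
by rewrite upd_eq in HC; rewrite -[sat _ _ _]/(e' 0 = e' C) E0 Ec; apply: H.
Qed.

End FormulaSemantics.

(** * The reductions *)

Section Reduction.
Variables (N : structure) (HF : models_F N) (HI : induction_for N (Sigma 1)).
Variables (m : nat) (HR : realizes N (RT2 m.+3)).
Variables (r : nat) (f : formula) (vs : seq nat) (h g : formula) (M : nat).
Local Notation env := (nat -> N).
Let PA : P_minus N := F_P_minus HF.
Hypothesis ff : forall v, free v f -> v < r.+2.
Hypothesis Ef : parameters_from_columns f = fexs vs h.
Hypothesis rM : r.+2 <= M.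
Hypothesis vsM : {in vs, forall v, v < M}.
Hypothesis Hg : bounded_form N m M h M g.

Section Instance.
Variable I : N -> Prop.
Hypothesis HsI : sets I.

Lemma sat_fgraph p E (e : env) : E 0 = I ->
  (forall j, j < r ->
    forall q, I (pair (num N 2) (pair (num N j) q)) <-> q = p j) ->
  sat E e (fgraph r f) <-> color_graph vs h I (base_env r p) (e 0) (e 1).
Proof.
move=> EI Hp; rewrite sat_fexs /color_graph -Ef.
have satf (e1 : env) : agree_off (iota 2 r) e e1 -> has_parameters r p e1 ->
    sat E e1 (parameters_from_columns f) <->
    sat (fun=> I) (arguments (base_env r p) (e 0) (e 1))
      (parameters_from_columns f).
  move=> He1 Hpar; rewrite -EI.
  apply: (iff_trans (sat_only_vI (E' := fun=> E 0) _ _ _)).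
  - exact: only_vI_columns.
  - by [].
  apply: sat_ext => // v; rewrite free_columns => /ff.
  rewrite /arguments /base_env /upd.
  case: v => [|[|v]] /=; do ?[by move=> _; apply: He1; rewrite mem_iota].
  by rewrite !ltnS => vr; rewrite vr subn2; apply: Hpar.
split=> [[e1 [He1 /sat_fand[Hpar Hs]]]|Hs].
  by apply/(satf e1 He1); [apply: (iffLR (sat_fparameters Hp e1 EI)) | ].
pose e1 i := if i \in iota 2 r then p (i - 2) else e i.
have He1 : agree_off (iota 2 r) e e1 by move=> i /negbTE Hi; rewrite /e1 Hi.
have Hpar : has_parameters r p e1.
  by move=> j jr; rewrite /e1 mem_iota /= add2n !ltnS jr subn2.
exists e1; split=> //; apply/sat_fand; split; last exact/satf.
exact: (iffRL (sat_fparameters Hp e1 EI)).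
Qed.

Lemma php_instanceP : is_instance (PHP r f) I -> exists p k,
  [/\ forall j, j < r ->
        forall q, I (pair (num N 2) (pair (num N j) q)) <-> q = p j,
      forall q, I (pair (num N 1) q) <-> q = k,
      forall x c, color_graph vs h I (base_env r p) x c -> lt c k,
      forall x c c', color_graph vs h I (base_env r p) x c ->
        color_graph vs h I (base_env r p) x c' -> c = c'
    & infinite (fun x => I (pair (num N 0) x)) /\
      forall x, I (pair (num N 0) x) ->
        exists c, color_graph vs h I (base_env r p) x c].
Proof.
pose E := set_env [:: I]; pose e : env := num_env [::].
have EI : E 0 = I by [].
rewrite /is_instance -/E -/e => -[Hparam [Hk [Huniq [Hinf [Hdom _]]]]].
have [p Hp] : exists p : env, forall j, j < r -> forall q,
    I (pair (num N 2) (pair (num N j) q)) <-> q = p j.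
  apply: (@finite_choice _ (zero N) (fun j t => forall q,
    I (pair (num N 2) (pair (num N j) q)) <-> q = t)) => j jr.
  have jr' : j \in iota 0 r by rewrite mem_iota.
  have [q Hq] := iffLR (sat_fconj _ _ _ _) Hparam j jr'.
  exists q => a; have := Hq a; rewrite -(eval_tnum (upd (upd e 1 q) 0 a) 2).
  by rewrite -(eval_tnum (upd (upd e 1 q) 0 a) j).
have Gr E0 := sat_fgraph (p := p) (E := E) E0 EI Hp.
have {Hk} [k [Hk Hlt]] := Hk.
exists p, k; split=> //.
- move=> q; have := Hk q; rewrite -(eval_tnum (upd (upd e r.+3 k) 0 q) 1).
  by rewrite /= /upd /= eqxx.
- move=> x c /(iffRL (Gr (upd (upd (upd e r.+3 k) 0 x) 1 c)))/(Hlt x c).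
  by rewrite /= /upd /= eqxx.
- move=> x c c' Hc Hc'; have [y Hy] := Huniq x.
  have Ey a : color_graph vs h I (base_env r p) x a -> a = y.
    move=> /(iffRL (Gr (upd (upd (upd e 0 x) r.+2 y) 1 a)))/(Hy a).
    by rewrite /= /upd /= eqxx.
  by rewrite (Ey _ Hc) (Ey _ Hc').
split=> [//|x Hx]; have [c Hc] := Hdom x Hx.
by exists c; apply/(Gr (upd (upd e 0 x) 1 c)).
Qed.

Let Phi := coloring_functional r M m vs Hg.1.
Let Psi := index_functional r M m vs Hg.1.

Let gM : forall v, free v g -> v < M + m := Hg.2.1.

Lemma base_env_bound p : exists t : N, forall i, lt (base_env r p i) t.
Proof.
have [t Ht] := finite_bound HF (iota 0 r.+3) (base_env r p).
exists t => i; case: (ltnP i r.+2) => Hi; first by apply: Ht; rewrite mem_iota leqW.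
suff -> : base_env r p i = base_env r p 0 by apply: Ht; rewrite mem_iota.
by rewrite /base_env (leq_gtF Hi) andbF.
Qed.

Lemma coloring_pair0 p i :
  coloring_set r M m vs g I p (pair (num N 0) i) <-> I (pair (num N 0) i).
Proof.
split=> [[[j [/(pair_inj PA)[_ ->]]] //|]|Hi]; last by left; exists i.
by move=> [a [b [zs [_ /(pair_inj PA)[/(num_inj PA)]]]]].
Qed.

Lemma coloring_pair1 p a b zs : size zs = m.+1 ->
  coloring_set r M m vs g I p (pair (num N 1) (tuple a (b :: zs))) <->
  triple_color m M vs g I (base_env r p) a b zs.
Proof.
move=> Ezs; split=> [[[j [/(pair_inj PA)[/(num_inj PA)]]] //|]|Hc].
  move=> [a' [b' [zs' [Ezs' /(pair_inj PA)[_ /(tuple_inj PA)[|-> [-> ->]]]]]]] //.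
  by rewrite /= Ezs Ezs'.
by right; exists a, b, zs.
Qed.

(** Both reductions share the coloring: S itself solves the set version, and the backward functional
    computes {c} for the index version. The data p, k and c are exported so that either solution
    formula can be checked. *)
Lemma reduction : is_instance (PHP r f) I ->
  total Phi [:: I] /\
  forall S, sets S -> holds (RT2 m.+3) (value Phi [:: I]) S -> exists p k c,
    [/\ forall j, j < r ->
         forall q, I (pair (num N 2) (pair (num N j) q)) <-> q = p j,
       (forall q, I (pair (num N 1) q) <-> q = k) /\ lt c k,
       infinite S /\ (forall x, S x -> I (pair (num N 0) x)),
       forall x, S x -> color_graph vs h I (base_env r p) x c
     & total Psi [:: I; S] /\ forall a, value Psi [:: I; S] a <-> a = c].
Proof.
move=> /php_instanceP[p [k [Hp Hk color_lt color_uniq [Xinf color_ex]]]].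
have Hsat x := sat_coloring PA rM vsM gM Hp (E := set_env [:: I])
  (num_env [:: x]) erefl.
have Hval x : value Phi [:: I] x <-> coloring_set r M m vs g I p x.
  exact: (Hsat x).1.
split=> [x|S HsS Hsol]; first exact: iff_trans (Hval x) (iff_sym (Hsat x).2).
have [|Sinf SX Shom] := holds_RT2 Hsol.
  move=> a; have [b [ab Xb]] := Xinf a; exists b; split=> //.
  exact/Hval/coloring_pair0.
have {}SX x : S x -> I (pair (num N 0) x).
  by move=> /SX/Hval/coloring_pair0.
have {}Shom a b zs a' b' zs' : size zs = m.+1 -> size zs' = m.+1 ->
    increasing S [:: a, b & zs] -> increasing S [:: a', b' & zs'] ->
    triple_color m M vs g I (base_env r p) a b zs <->
    triple_color m M vs g I (base_env r p) a' b' zs'.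
  move=> Ezs Ezs' Hs Hs'; rewrite -!coloring_pair1 // -!Hval.
  by apply: Shom => //=; rewrite ?Ezs ?Ezs'.
have Hb := base_env_bound p.
have [c Hc] := common_color HF HI HR Hg HsI Hb color_lt color_uniq color_ex
  HsS Sinf SX Shom.
have [x0 [_ Sx0]] := Sinf (zero N).
have Hindex a : index_set r M m vs g I p S a <-> a = c.
  have Hx x := color_from_homogeneous HF HI HR Hg HsI Hb color_lt color_uniq
    color_ex HsS Sinf SX Shom (x := x) a.
  split=> [[x [Sx Hxa]]|Eac].
    exact: color_uniq (iffRL (Hx x Sx) Hxa) (Hc x Sx).
  by exists x0; split=> //; apply: (iffLR (Hx x0 Sx0)); rewrite Eac; apply: Hc.
have HsatP a := sat_index PA rM vsM gM Hp (E := set_env [:: I; S])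
  (num_env [:: a]) erefl.
have HvalP a : value Psi [:: I; S] a <-> a = c.
  by rewrite -Hindex; exact: (HsatP a).1.
exists p, k, c; split=> //.
  by split=> //; apply: (color_lt x0); apply: Hc.
split=> // a; rewrite HvalP (HsatP a).2; split=> [-> c' /Hindex //|].
by apply; apply/Hindex.
Qed.

Lemma PHP_solution p c (S : N -> Prop) : is_instance (PHP r f) I ->
  (forall j, j < r ->
    forall q, I (pair (num N 2) (pair (num N j) q)) <-> q = p j) ->
  infinite S -> (forall x, S x -> I (pair (num N 0) x)) ->
  (forall x, S x -> color_graph vs h I (base_env r p) x c) ->
  holds (PHP r f) I S.
Proof.
move=> HI' Hp Sinf SX Hc; left; split.
  apply: iffLR HI'; apply: sat_only_vI => //; exact: only_vI_php_instance.
apply/sat_fconj3; split; [exact: Sinf | exact: SX |].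
exists c => x Sx; apply: (iffRL (sat_fgraph (p := p) _ _ _)) => //.
exact: Hc.
Qed.

Lemma PHP_index_solution p k c (S T : N -> Prop) : is_instance (PHP r f) I ->
  (forall j, j < r ->
    forall q, I (pair (num N 2) (pair (num N j) q)) <-> q = p j) ->
  (forall q, I (pair (num N 1) q) <-> q = k) -> lt c k ->
  infinite S -> (forall x, S x -> I (pair (num N 0) x)) ->
  (forall x, S x -> color_graph vs h I (base_env r p) x c) ->
  (forall a, T a <-> a = c) -> holds (PHP_index r f) I T.
Proof.
move=> HI' Hp Hk ck Sinf SX Hc HT; left; split.
  apply: iffLR HI'; apply: sat_only_vI => //; exact: only_vI_php_instance.
exists c; apply/sat_fconj3; split; first exact: HT.
  exists k; apply/sat_fand; split; last by rewrite /= /upd /= eqxx.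
  apply: (iffRL (sat_fcol _ _ 1 _)).
  by apply/Hk; rewrite /= upd_eq.
move=> y; have [x [yx Sx]] := Sinf y; exists x; apply/sat_fconj3; split.
- by rewrite /= /upd /= eqxx.
- exact: SX.
- by apply: (iffRL (sat_fgraph (p := p) _ _ _)) => //; apply: Hc.
Qed.

End Instance.
End Reduction.

Theorem theorem10 (n : nat) (N : structure) :
  1 < n ->
  models_F N ->
  realizes N (RT2 n.+1) ->
  induction_for N (Sigma 1) ->
  forall (r : nat) (f : formula),
    Sigma n.-1 f ->
    (forall v : nat, free v f -> v < r.+2) ->
    strong_weihrauch N (PHP r f) (RT2 n.+1) /\
    weihrauch N (PHP_index r f) (RT2 n.+1).
Proof.
(* Here n = m + 2, so the coloring is Sigma_(m+1): an existential block [vs] before a Pi_m formula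
   h. *)
case: n => [|[|m]] // _ HF HR HI r f Hf ff.
have [vs [h [Ef Hh]]] := Sigma_block (Sigma_columns Hf).
(* M lies above all variables of the graph formula as well as above x, c and the r parameters, so
   variables from M on are free for bounds and tuple entries. *)
pose M := maxn (fbound (parameters_from_columns f)) r.+2.
have rM : r.+2 <= M by rewrite leq_maxr.
have [vsM hM] : {in vs, forall v, v < M} /\ fbound h <= M.
  by apply: fbound_fexs; rewrite -Ef leq_maxl.
have [g Hg] := bounded_form_exists HF HI HR (or_intror Hh) hM (leqnn M).
have red := reduction HF HI HR ff Ef rM vsM Hg.
split; split=> //.
  exists (coloring_functional r M m vs Hg.1), copy_functional => I HsI Hinst.
  have [Htot Hsol] := red I HsI Hinst; split=> // S HsS HS.
  have [p [k [c [Hp _ [Sinf SX] Hc _]]]] := Hsol S HsS HS.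
  split=> //; exact: (PHP_solution ff Ef Hinst Hp Sinf SX Hc).
exists (coloring_functional r M m vs Hg.1), (index_functional r M m vs Hg.1).
move=> I HsI Hinst.
have [Htot Hsol] := red I HsI Hinst; split=> // S HsS HS.
have [p [k [c [Hp [Hk ck] [Sinf SX] Hc [HtotP HT]]]]] := Hsol S HsS HS.
split=> //; exact: (PHP_index_solution ff Ef Hinst Hp Hk ck Sinf SX Hc HT).
Qed.
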